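(* Let $d\in\mathbb{N}$, and let $D$ be a non-empty subset of $\mathbb{Z}/d\mathbb{Z}$ with corresponding solution $X_D=(\mathrm{x}_1,\dots,\mathrm{x}_{d-1})$ of the E-system. Then $\mathrm{tr}_{d,D}(\alpha\#\beta)=\mathrm{tr}_{d,D}(\alpha)\,\mathrm{tr}_{d,D}(\beta)$ for all $n,m\in\mathbb{N}$ and all framed braids $\alpha\in\mathcal{F}_n$, $\beta\in\mathcal{F}_m$ if and only if $\mathrm{x}_1^d=1$ and $\mathrm{x}_k=\mathrm{x}_1^k$ for all $k=1,\dots,d-1$.
   Context: Framed braid group: $\mathcal{F}_n\cong\mathbb{Z}^n\rtimes B_n$ is generated by the braid generators $\sigma_1,\dots,\sigma_{n-1}$ of $B_n$ and framing generators $t_1,\dots,t_n$, with the braid relations, $t_it_j=t_jt_i$ and $t_j\sigma_i=\sigma_it_{s_i(j)}$, $s_i=(i,i+1)$. $\mathcal{F}_{d,n}$ is the quotient by $t_j^d=1$ for all $j$; put $e_i:=\frac1d\sum_{s=1}^{d}t_i^st_{i+1}^{-s}\in\mathbb{C}\mathcal{F}_{d,n}$. Yokonuma--Hecke algebra: for fixed $q\in\mathbb{C}\setminus\{0\}$, $\mathrm{Y}_{d,n}(q)$ is the quotient of $\mathbb{C}\mathcal{F}_{d,n}$ by the ideal generated by $\sigma_i^2-1-(q-q^{-1})e_i\sigma_i$; $g_i$ is the image of $\sigma_i$, and the image of $t_j$ is still denoted $t_j$. There are natural inclusions $\mathrm{Y}_{d,n}(q)\subset\mathrm{Y}_{d,n+1}(q)$.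 Trace: for indeterminates $z,x_1,\dots,x_{d-1}$, $\mathrm{tr}_d:\bigcup_{n\ge0}\mathrm{Y}_{d,n}(q)\to\mathbb{C}[z,x_1,\dots,x_{d-1}]$ is the unique linear map (Juyumaya) with $\mathrm{tr}_d(ab)=\mathrm{tr}_d(ba)$, $\mathrm{tr}_d(1)=1$, $\mathrm{tr}_d(ag_n)=z\,\mathrm{tr}_d(a)$, $\mathrm{tr}_d(at_{n+1}^s)=x_s\,\mathrm{tr}_d(a)$ ($1\le s\le d-1$) for all $n$ and $a,b\in\mathrm{Y}_{d,n}(q)$. Specialized trace: the E-system is the system $E^{(m)}=x_mE$ ($1\le m\le d-1$) over $\mathbb{C}$, where $E^{(m)}=\frac1d\sum_{s=0}^{d-1}x_{m+s}x_{d-s}$, $E=E^{(0)}$, indices mod $d$, $x_0=1$ (also $\mathrm{x}_0=1$). Its solutions are parametrized (Gérardin) by the non-empty subsets $D\subseteq\mathbb{Z}/d\mathbb{Z}$: the solution $X_D=(\mathrm{x}_1,\dots,\mathrm{x}_{d-1})$ is $\mathrm{x}_k=\frac1{|D|}\sum_{m\in D}\exp(2\pi km\sqrt{-1}/d)$. $\mathrm{tr}_{d,D}:\bigcup_n\mathrm{Y}_{d,n}(q)\to\mathbb{C}[z]$ is $\mathrm{tr}_d$ with $(x_1,\dots,x_{d-1})$ specialized to $X_D$. For $\alpha\in\mathcal{F}_n$, $\mathrm{tr}_{d,D}(\alpha)$ means $\mathrm{tr}_{d,D}$ of its image under $\sigma_i\mapsto g_i$, $t_j\mapsto t_j$. Connected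 sum: for $\alpha\in\mathcal{F}_n$, $\beta\in\mathcal{F}_m$, $\alpha\#\beta:=\alpha^{[0]}\beta^{[n-1]}\in\mathcal{F}_{n+m-1}$, where $\alpha^{[0]}$ is the natural image of $\alpha$ in $\mathcal{F}_{n+m-1}$ and $\beta^{[n-1]}$ is the image of $\beta$ under $\sigma_i\mapsto\sigma_{n+i-1}$ ($1\le i\le m-1$), $t_j\mapsto t_{n+j-1}$ ($1\le j\le m$). *)

(* Defs.v *)
From HB Require Import structures.
From mathcomp Require Import all_boot all_order all_algebra perm generic_quotient.
From mathcomp Require Import finmap mpoly monalg complex boolp reals trigo.

Set Implicit Arguments.
Unset Strict Implicit.
Unset Printing Implicit Defensive.

Import Order.TTheory GRing.Theory Num.Theory.

Local Open Scope quotient_scope.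

(* The letter (s, false) is the generator s; (s, true) is its inverse. *)
Notation word S := (seq (S * bool)).

Section PresentedGroup.
Variables (S : choiceType) (rel : word S -> word S -> Prop).
Local Open Scope group_scope.

Definition word_inv (w : word S) : word S := rev [seq (x.1, ~~ x.2) | x <- w].

Inductive word_equiv : word S -> word S -> Prop :=
| WordRefl u : word_equiv u u
| WordSym u v : word_equiv u v -> word_equiv v u
| WordTrans u v w : word_equiv u v -> word_equiv v w -> word_equiv u w
| WordCat u u' v v' :
    word_equiv u u' -> word_equiv v v' -> word_equiv (u ++ v) (u' ++ v')
| WordCancel s b : word_equiv [:: (s, b); (s, ~~ b)] [::]
| WordRel u v : rel u v -> word_equiv u v.

Definition word_equivb (u v : word S) : bool := `[< word_equiv u v >].

Lemma word_equivb_is_equiv : equiv_class_of word_equivb.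
Proof.
split=> [u|u v|v u w].
- exact/asboolP/WordRefl.
- by apply/asboolP/asboolP; apply: WordSym.
- by move=> /asboolP uv /asboolP vw; apply/asboolP/(WordTrans uv vw).
Qed.

Canonical word_equivb_equiv := EquivRelPack word_equivb_is_equiv.

Definition pgroup : Type := {eq_quot word_equivb}.
HB.instance Definition _ := EqQuotient.on pgroup.
HB.instance Definition _ := Choice.on pgroup.

Definition pword (w : word S) : pgroup := \pi_pgroup w.
Definition pgen (s : S) : pgroup := pword [:: (s, false)].

Lemma pwordP u v : word_equiv u v <-> pword u = pword v.
Proof.
by split=> [uv|/eqquotP/asboolP//]; apply/eqquotP/asboolP.
Qed.

Lemma repr_pword w : word_equiv (repr (pword w)) w.
Proof. by apply/pwordP; rewrite /pword reprK. Qed.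

Lemma pgroupP (P : pgroup -> Prop) : (forall w, P (pword w)) -> forall u, P u.
Proof. by move=> Pw u; rewrite -[u]reprK; apply: Pw. Qed.

Lemma word_inv_cat u v : word_inv (u ++ v) = word_inv v ++ word_inv u.
Proof. by rewrite /word_inv map_cat rev_cat. Qed.

Lemma word_invK : involutive word_inv.
Proof.
move=> w; rewrite /word_inv map_rev revK -map_comp -[RHS]map_id.
by apply: eq_map => -[s b] /=; rewrite negbK.
Qed.

Lemma word_equiv_invr w : word_equiv (w ++ word_inv w) [::].
Proof.
elim: w => [|[s b] w IHw]; first exact: WordRefl.
rewrite -cat1s word_inv_cat -catA (catA w).
apply: WordTrans (WordCancel s b).
rewrite -[[:: _; _]]/([:: (s, b)] ++ ([::] ++ [:: (s, ~~ b)])).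
by apply: WordCat (WordRefl _) (WordCat IHw (WordRefl _)).
Qed.

Lemma word_equiv_invl w : word_equiv (word_inv w ++ w) [::].
Proof. by rewrite -{2}[w]word_invK; apply: word_equiv_invr. Qed.

Lemma word_equiv_inv u v : word_equiv u v -> word_equiv (word_inv u) (word_inv v).
Proof.
move=> uv; rewrite -[word_inv u]cats0.
apply: WordTrans (_ : word_equiv (word_inv u ++ (v ++ word_inv v)) _).
  by apply: WordCat (WordRefl _) (WordSym (word_equiv_invr v)).
rewrite catA -[X in word_equiv _ X]cat0s; apply: WordCat (WordRefl _).
apply: WordTrans (word_equiv_invl u).
by apply: WordCat (WordRefl _) (WordSym uv).
Qed.

Definition pmul (u v : pgroup) : pgroup := pword (repr u ++ repr v).
Definition pone : pgroup := pword [::].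
Definition pinv (u : pgroup) : pgroup := pword (word_inv (repr u)).

Lemma pmulE u v : pmul (pword u) (pword v) = pword (u ++ v).
Proof. by apply/pwordP; apply: WordCat; apply: repr_pword. Qed.

Lemma pinvE u : pinv (pword u) = pword (word_inv u).
Proof. by apply/pwordP/word_equiv_inv/repr_pword. Qed.

Fact pmulA : associative pmul.
Proof.
elim/pgroupP => u; elim/pgroupP => v; elim/pgroupP => w.
by rewrite !pmulE catA.
Qed.
Fact pmul1 : left_id pone pmul.
Proof. by elim/pgroupP => u; rewrite pmulE. Qed.
Fact pmulr1 : right_id pone pmul.
Proof. by elim/pgroupP => u; rewrite pmulE cats0. Qed.
Fact pmulV : left_inverse pone pinv pmul.
Proof.
by elim/pgroupP => u; rewrite pinvE pmulE; apply/pwordP/word_equiv_invl.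
Qed.
Fact pmulrV : right_inverse pone pinv pmul.
Proof.
by elim/pgroupP => u; rewrite pinvE pmulE; apply/pwordP/word_equiv_invr.
Qed.

HB.instance Definition _ :=
  isGroup.Build pgroup pmulA pmul1 pmulr1 pmulV pmulrV.

Lemma pwordM u v : pword (u ++ v) = pword u * pword v.
Proof. by rewrite -pmulE. Qed.

Section Lift.
Variables (G : groupType) (f : S -> G).

Definition letter_eval (x : S * bool) : G := if x.2 then (f x.1)^-1 else f x.1.
Definition word_eval (w : word S) : G := \big[*%g/1]_(x <- w) letter_eval x.
Definition pgroup_lift (u : pgroup) : G := word_eval (repr u).

Lemma word_eval_cat u v : word_eval (u ++ v) = word_eval u * word_eval v.
Proof. by rewrite /word_eval big_cat. Qed.

Hypothesis f_rel : forall u v, rel u v -> word_eval u = word_eval v.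

Lemma word_eval_equiv u v : word_equiv u v -> word_eval u = word_eval v.
Proof.
elim=> // {u v} [u v w _ -> _ -> //|u u' v v' _ IHu _ IHv|s b].
  by rewrite !word_eval_cat IHu IHv.
rewrite /word_eval !big_cons !big_nil mulg1 /letter_eval /=.
by case: b; rewrite /= ?mulVg ?mulgV.
Qed.

Lemma pgroup_lift_word w : pgroup_lift (pword w) = word_eval w.
Proof. exact/word_eval_equiv/repr_pword. Qed.

Lemma pgroup_lift_gen s : pgroup_lift (pgen s) = f s.
Proof. by rewrite pgroup_lift_word /word_eval big_seq1. Qed.

Lemma pgroup_liftM : {morph pgroup_lift : u v / u * v}.
Proof.
elim/pgroupP => u; elim/pgroupP => v.
by rewrite -pwordM !pgroup_lift_word word_eval_cat.
Qed.

End Lift.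
End PresentedGroup.

Section GroupAlgebra.
Variables (R : nzRingType) (G : groupType).
Local Open Scope ring_scope.
Local Notation "x @_ g" := (monalg.mcoeff g x) : ring_scope.

Definition galg : Type := {malg R[G]}.
HB.instance Definition _ := GRing.Lmodule.on galg.

Definition gbasis (g : G) : galg := << g >>.

Definition galg_mul (x y : galg) : galg :=
  \sum_(g <- msupp x) \sum_(h <- msupp y) << x@_g * y@_h *g (g * h)%g >>.

Lemma galg_mulw (d e : {fset G}) (x y : galg) :
    (msupp x `<=` d)%fset -> (msupp y `<=` e)%fset ->
  galg_mul x y = \sum_(g <- d) \sum_(h <- e) << x@_g * y@_h *g (g * h)%g >>.
Proof.
move=> le_d le_e; rewrite /galg_mul (big_fset_incl _ le_d) /=; last first.
  by move=> g _ /mcoeff_outdom xg; rewrite big1 // => h; rewrite xg mul0r monalgU0.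
apply: eq_bigr => g _; apply: big_fset_incl => // h _ /mcoeff_outdom ->.
by rewrite mulr0 monalgU0.
Qed.

Lemma galg_mulDl : left_distributive galg_mul +%R.
Proof.
move=> x y z; pose d := (msupp x `|` msupp y)%fset.
rewrite !(@galg_mulw d (msupp z)) ?fsubsetUl ?fsubsetUr ?msuppD_le //.
rewrite -big_split; apply: eq_bigr => g _; rewrite -big_split.
by apply: eq_bigr => h _; rewrite mcoeffD mulrDl monalgUD.
Qed.

Lemma galg_mulDr : right_distributive galg_mul +%R.
Proof.
move=> z x y; pose d := (msupp x `|` msupp y)%fset.
rewrite !(@galg_mulw (msupp z) d) ?fsubsetUl ?fsubsetUr ?msuppD_le //.
rewrite -big_split; apply: eq_bigr => g _; rewrite -big_split.
by apply: eq_bigr => h _; rewrite mcoeffD mulrDr monalgUD.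
Qed.

Lemma galg_mul0l : left_zero 0 galg_mul.
Proof. by move=> x; rewrite /galg_mul msupp0 big_seq_fset0. Qed.

Lemma galg_mul0r : right_zero 0 galg_mul.
Proof.
by move=> x; rewrite /galg_mul big1 // => g _; rewrite msupp0 big_seq_fset0.
Qed.

Lemma galg_mulUU a b g h :
  galg_mul << a *g g >> << b *g h >> = << a * b *g (g * h)%g >>.
Proof.
by rewrite (galg_mulw msuppU_le msuppU_le) !big_seq_fset1 !mcoeffUU.
Qed.

Lemma galg_mul_suml (I : Type) (r : seq I) (F : I -> galg) y :
  galg_mul (\sum_(i <- r) F i) y = \sum_(i <- r) galg_mul (F i) y.
Proof.
by apply: (big_morph (galg_mul^~ y)) => [u v|]; [exact: galg_mulDl|exact: galg_mul0l].
Qed.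

Lemma galg_mul_sumr (I : Type) (r : seq I) (F : I -> galg) x :
  galg_mul x (\sum_(i <- r) F i) = \sum_(i <- r) galg_mul x (F i).
Proof.
by apply: (big_morph (galg_mul x)) => [u v|]; [exact: galg_mulDr|exact: galg_mul0r].
Qed.

Lemma galg_ind (P : galg -> Prop) : P 0 ->
  (forall x y, P x -> P y -> P (x + y)) -> (forall a g, P << a *g g >>) ->
  forall x, P x.
Proof. by move=> P0 PD PU x; rewrite [x]monalgE; apply: big_ind. Qed.

Fact galg_mulA : associative galg_mul.
Proof.
move=> x y z; elim/galg_ind: x => [|u v Hu Hv|a g].
- by rewrite !galg_mul0l.
- by rewrite !galg_mulDl Hu Hv.
elim/galg_ind: y => [|u v Hu Hv|b h].
- by rewrite !(galg_mul0l, galg_mul0r).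
- by rewrite galg_mulDl !galg_mulDr galg_mulDl Hu Hv.
elim/galg_ind: z => [|u v Hu Hv|c k].
- by rewrite !galg_mul0r.
- by rewrite !galg_mulDr Hu Hv.
by rewrite !galg_mulUU mulrA mulgA.
Qed.

Fact galg_mul1l : left_id (gbasis 1%g) galg_mul.
Proof.
elim/galg_ind => [|u v Hu Hv|a g]; first exact: galg_mul0r.
- by rewrite galg_mulDr Hu Hv.
- by rewrite galg_mulUU mul1r mul1g.
Qed.

Fact galg_mul1r : right_id (gbasis 1%g) galg_mul.
Proof.
elim/galg_ind => [|u v Hu Hv|a g]; first exact: galg_mul0l.
- by rewrite galg_mulDl Hu Hv.
- by rewrite galg_mulUU mulr1 mulg1.
Qed.

Fact galg_one_neq0 : gbasis 1%g != 0.
Proof. by rewrite monalgU_eq0 oner_neq0. Qed.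

HB.instance Definition _ := GRing.Zmodule_isNzRing.Build galg
  galg_mulA galg_mul1l galg_mul1r galg_mulDl galg_mulDr galg_one_neq0.

Lemma galgMUU a b g h :
  (<< a *g g >> : galg) * (<< b *g h >> : galg) = << a * b *g (g * h)%g >>.
Proof. exact: galg_mulUU. Qed.

Lemma gbasisM g h : gbasis (g * h)%g = gbasis g * gbasis h.
Proof. by rewrite [RHS]galg_mulUU mul1r. Qed.

Lemma gbasis1 : gbasis 1%g = 1. Proof. by []. Qed.

Lemma galg_scaleU a g : a *: gbasis g = << a *g g >>.
Proof. by apply/malgP => h; rewrite mcoeffZ !mcoeffU mulrnAr mulr1. Qed.

Fact galg_scaleAl a (x y : galg) : a *: (x * y) = (a *: x) * y.
Proof.
elim/galg_ind: x => [|u v Hu Hv|b g]; first by rewrite !(mul0r, scaler0).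
- by rewrite mulrDl !scalerDr mulrDl Hu Hv.
elim/galg_ind: y => [|u v Hu Hv|c h]; first by rewrite !(mulr0, scaler0).
- by rewrite !mulrDr !scalerDr Hu Hv.
rewrite galgMUU -[<< b *g g >>]galg_scaleU scalerA !galg_scaleU.
by rewrite galgMUU -galg_scaleU scalerA galg_scaleU mulrA.
Qed.

HB.instance Definition _ := GRing.Lmodule_isLalgebra.Build R galg galg_scaleAl.
End GroupAlgebra.

Section GroupAlgebraCom.
Variables (R : comNzRingType) (G : groupType).
Local Open Scope ring_scope.

Fact galg_scaleAr a (x y : galg R G) : a *: (x * y) = x * (a *: y).
Proof.
elim/galg_ind: x => [|u v Hu Hv|b g]; first by rewrite !(mul0r, scaler0).
- by rewrite !mulrDl scalerDr Hu Hv.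
elim/galg_ind: y => [|u v Hu Hv|c h]; first by rewrite !(mulr0, scaler0, mulr0).
- by rewrite !(mulrDr, scalerDr) Hu Hv.
rewrite galgMUU -[<< c *g h >>]galg_scaleU scalerA !galg_scaleU.
by rewrite galgMUU -galg_scaleU scalerA galg_scaleU mulrCA.
Qed.

HB.instance Definition _ :=
  GRing.Lalgebra_isAlgebra.Build R (galg R G) galg_scaleAr.
End GroupAlgebraCom.

Section GroupAlgebraMap.
Variables (R : comNzRingType) (G H : groupType) (f : G -> H).
Local Open Scope ring_scope.
Local Notation "x @_ g" := (monalg.mcoeff g x) : ring_scope.

Definition galg_map (x : galg R G) : galg R H :=
  \sum_(g <- msupp x) x@_g *: gbasis R (f g).

Lemma galg_mapw (d : {fset G}) (x : galg R G) : (msupp x `<=` d)%fset ->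
  galg_map x = \sum_(g <- d) x@_g *: gbasis R (f g).
Proof.
move=> le_d; apply: big_fset_incl => // g _ /mcoeff_outdom ->.
by rewrite scale0r.
Qed.

Fact galg_map_is_linear : linear galg_map.
Proof.
move=> a x y; pose d := (msupp x `|` msupp y)%fset.
rewrite !(@galg_mapw d) ?fsubsetUl ?fsubsetUr //; last first.
  apply: (fsubset_trans (msuppD_le _ _)).
  by apply: fsetSU; apply: msuppZ_le.
rewrite scaler_sumr -big_split; apply: eq_bigr => g _.
by rewrite mcoeffD mcoeffZ scalerDl scalerA.
Qed.
HB.instance Definition _ :=
  GRing.isLinear.Build R (galg R G) (galg R H) _ galg_map galg_map_is_linear.

Lemma galg_mapU a g : galg_map << a *g g >> = a *: gbasis R (f g).
Proof. by rewrite (galg_mapw msuppU_le) big_seq_fset1 mcoeffUU. Qed.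

Lemma galg_map_basis g : galg_map (gbasis R g) = gbasis R (f g).
Proof. by rewrite galg_mapU scale1r. Qed.

Lemma galg_mapM : {morph f : g h / (g * h)%g} -> {morph galg_map : x y / x * y}.
Proof.
move=> fM x y; elim/galg_ind: x => [|u v Hu Hv|b g].
- by rewrite mul0r linear0 mul0r.
- by rewrite mulrDl !linearD /= mulrDl Hu Hv.
elim/galg_ind: y => [|u v Hu Hv|c h].
- by rewrite mulr0 linear0 mulr0.
- by rewrite mulrDr !linearD /= mulrDr Hu Hv.
by rewrite galgMUU !galg_mapU fM gbasisM -scalerAl -scalerAr scalerA.
Qed.
End GroupAlgebraMap.

Section IdealQuotient.
Variables (K : comNzRingType) (A : algType K) (S : A -> Prop).
Local Open Scope ring_scope.

Inductive ideal_span : A -> Prop :=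
| IdealGen a s b : S s -> ideal_span (a * s * b)
| Ideal0 : ideal_span 0
| IdealD x y : ideal_span x -> ideal_span y -> ideal_span (x + y).

Lemma ideal_spanMl a x : ideal_span x -> ideal_span (a * x).
Proof.
elim=> [b s c Ss||u v _ IHu _ IHv]; first by rewrite !mulrA; apply: IdealGen.
- by rewrite mulr0; apply: Ideal0.
- by rewrite mulrDr; apply: IdealD.
Qed.

Lemma ideal_spanMr a x : ideal_span x -> ideal_span (x * a).
Proof.
elim=> [b s c Ss||u v _ IHu _ IHv]; first by rewrite -mulrA; apply: IdealGen.
- by rewrite mul0r; apply: Ideal0.
- by rewrite mulrDl; apply: IdealD.
Qed.

Lemma ideal_spanZ a x : ideal_span x -> ideal_span (a *: x).
Proof. by rewrite -mulr_algl; apply: ideal_spanMl. Qed.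

Lemma ideal_spanN x : ideal_span x -> ideal_span (- x).
Proof. by rewrite -scaleN1r; apply: ideal_spanZ. Qed.

Lemma ideal_spanB x y : ideal_span x -> ideal_span y -> ideal_span (x - y).
Proof. by move=> Ix /ideal_spanN; apply: IdealD. Qed.

Definition ideal_equivb (x y : A) : bool := `[< ideal_span (x - y) >].

Lemma ideal_equivb_is_equiv : equiv_class_of ideal_equivb.
Proof.
split=> [x|x y|y x z].
- by apply/asboolP; rewrite subrr; apply: Ideal0.
- by apply: asbool_equiv_eq; split=> /ideal_spanN; rewrite opprB.
- move=> /asboolP xy /asboolP yz; apply/asboolP.
  by rewrite -[x in x - z](subrK y) -addrA; apply: IdealD.
Qed.

Canonical ideal_equivb_equiv := EquivRelPack ideal_equivb_is_equiv.

Definition qalg : Type := {eq_quot ideal_equivb}.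
HB.instance Definition _ := EqQuotient.on qalg.
HB.instance Definition _ := Choice.on qalg.

Definition qproj (x : A) : qalg := \pi_qalg x.

Lemma qprojP x y : ideal_span (x - y) <-> qproj x = qproj y.
Proof. by split=> [xy|/eqquotP/asboolP//]; apply/eqquotP/asboolP. Qed.

Lemma repr_qproj x : ideal_span (repr (qproj x) - x).
Proof. by apply/qprojP; rewrite /qproj reprK. Qed.

Lemma qalgP (P : qalg -> Prop) : (forall x, P (qproj x)) -> forall y, P y.
Proof. by move=> Px y; rewrite -[y]reprK; apply: Px. Qed.

Definition qadd (x y : qalg) : qalg := qproj (repr x + repr y).
Definition qopp (x : qalg) : qalg := qproj (- repr x).
Definition qmul (x y : qalg) : qalg := qproj (repr x * repr y).
Definition qscale (a : K) (x : qalg) : qalg := qproj (a *: repr x).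

Lemma qaddE x y : qadd (qproj x) (qproj y) = qproj (x + y).
Proof. by apply/qprojP; rewrite opprD addrACA; apply: IdealD; apply: repr_qproj. Qed.

Lemma qoppE x : qopp (qproj x) = qproj (- x).
Proof. by apply/qprojP; rewrite -opprD; apply/ideal_spanN/repr_qproj. Qed.

Lemma qmulE x y : qmul (qproj x) (qproj y) = qproj (x * y).
Proof.
apply/qprojP; rewrite -(subrKA (x * repr (qproj y))) -mulrBl -mulrBr.
by apply: IdealD; [apply: ideal_spanMr|apply: ideal_spanMl]; apply: repr_qproj.
Qed.

Lemma qscaleE a x : qscale a (qproj x) = qproj (a *: x).
Proof. by apply/qprojP; rewrite -scalerBr; apply/ideal_spanZ/repr_qproj. Qed.

Let qE := (qaddE, qoppE, qmulE, qscaleE).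

Fact qaddA : associative qadd.
Proof. by do 3!elim/qalgP=> ?; rewrite !qE addrA. Qed.
Fact qaddC : commutative qadd.
Proof. by do 2!elim/qalgP=> ?; rewrite !qE addrC. Qed.
Fact qadd0 : left_id (qproj 0) qadd.
Proof. by elim/qalgP=> ?; rewrite !qE add0r. Qed.
Fact qaddN : left_inverse (qproj 0) qopp qadd.
Proof. by elim/qalgP=> ?; rewrite !qE addNr. Qed.

HB.instance Definition _ := GRing.isZmodule.Build qalg qaddA qaddC qadd0 qaddN.

Lemma qprojD x y : qproj x + qproj y = qproj (x + y). Proof. exact: qaddE. Qed.

Fact qmulA : associative qmul.
Proof. by do 3!elim/qalgP=> ?; rewrite !qE mulrA. Qed.
Fact qmul1l : left_id (qproj 1) qmul.
Proof. by elim/qalgP=> ?; rewrite !qE mul1r. Qed.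
Fact qmul1r : right_id (qproj 1) qmul.
Proof. by elim/qalgP=> ?; rewrite !qE mulr1. Qed.
Fact qmulDl : left_distributive qmul +%R.
Proof. by move=> x y z; elim/qalgP: x => x; elim/qalgP: y => y; elim/qalgP: z => z; rewrite qprojD !qmulE qprojD mulrDl. Qed.
Fact qmulDr : right_distributive qmul +%R.
Proof. by move=> x y z; elim/qalgP: x => x; elim/qalgP: y => y; elim/qalgP: z => z; rewrite qprojD !qmulE qprojD mulrDr. Qed.

HB.instance Definition _ :=
  GRing.Zmodule_isPzRing.Build qalg qmulA qmul1l qmul1r qmulDl qmulDr.

Fact qscaleA a b x : qscale a (qscale b x) = qscale (a * b) x.
Proof. by elim/qalgP: x => ?; rewrite !qE scalerA. Qed.
Fact qscale1 : left_id 1 qscale.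
Proof. by elim/qalgP=> ?; rewrite !qE scale1r. Qed.
Fact qscaleDr : right_distributive qscale +%R.
Proof.
move=> a x y; elim/qalgP: x => x; elim/qalgP: y => y.
by rewrite qprojD !qscaleE qprojD scalerDr.
Qed.
Fact qscaleDl x : {morph qscale^~ x : a b / a + b}.
Proof. by move=> a b; elim/qalgP: x => x; rewrite !qscaleE qprojD scalerDl. Qed.

HB.instance Definition _ := GRing.Zmodule_isLmodule.Build K qalg
  qscaleA qscale1 qscaleDr qscaleDl.

Fact qproj_is_linear : linear qproj.
Proof. by move=> a x y; rewrite [_ *: qproj _]qscaleE [RHS]qaddE. Qed.
HB.instance Definition _ :=
  GRing.isLinear.Build K A qalg _ qproj qproj_is_linear.

Fact qproj_is_monoid_morphism : monoid_morphism qproj.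
Proof. by split=> // x y; rewrite [RHS]qmulE. Qed.
HB.instance Definition _ :=
  GRing.isMonoidMorphism.Build A qalg qproj qproj_is_monoid_morphism.

Lemma qscaleAl a (x y : qalg) : a *: (x * y) = (a *: x) * y.
Proof.
elim/qalgP: x => x; elim/qalgP: y => y.
by rewrite -rmorphM -!linearZ -rmorphM /= scalerAl.
Qed.
Lemma qscaleAr a (x y : qalg) : a *: (x * y) = x * (a *: y).
Proof.
elim/qalgP: x => x; elim/qalgP: y => y.
by rewrite -rmorphM -!linearZ -rmorphM /= scalerAr.
Qed.

Lemma qproj_gen s : S s -> qproj s = 0.
Proof.
move=> Ss; rewrite -(rmorph0 qproj); apply/qprojP.
by rewrite subr0 -[s]mulr1 -[s]mul1r; apply: IdealGen.
Qed.

Definition qlift (B : pzRingType) (f : A -> B) (x : qalg) : B := f (repr x).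

Lemma qliftE (B : pzRingType) (f : {rmorphism A -> B}) :
  (forall s, S s -> f s = 0) -> forall x, qlift f (qproj x) = f x.
Proof.
move=> fS x; apply/subr0_eq; rewrite -rmorphB.
elim: (repr_qproj x) => [a s b /fS fs0||u v _ fu0 _ fv0].
- by rewrite !rmorphM fs0 mulr0 mul0r.
- exact: rmorph0.
- by rewrite rmorphD fu0 fv0 addr0.
Qed.
End IdealQuotient.

Section FramedBraids.
Variable n : nat.

(* [inl i] is the braid generator sigma_(i+1), [inr j] the framing generator *)
(* t_(j+1).                                                                  *)
Definition fgen : Type := ('I_n.-1 + 'I_n)%type.
HB.instance Definition _ := Choice.on fgen.

Fact strand_r_subproof (i : 'I_n.-1) : i.+1 < n.
Proof. by rewrite -ltn_predRL. Qed.

(* The two strands crossed by sigma_(i+1). *)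
Definition strand_l (i : 'I_n.-1) : 'I_n := widen_ord (leq_pred n) i.
Definition strand_r (i : 'I_n.-1) : 'I_n := Ordinal (strand_r_subproof i).

Definition sigmaw (i : 'I_n.-1) : word fgen := [:: (inl i, false)].
Definition framew (j : 'I_n) : word fgen := [:: (inr j, false)].

Inductive framed_braid_rel : word fgen -> word fgen -> Prop :=
| BraidFar (i j : 'I_n.-1) : i.+1 < j ->
    framed_braid_rel (sigmaw i ++ sigmaw j) (sigmaw j ++ sigmaw i)
| BraidNear (i j : 'I_n.-1) : j = i.+1 :> nat ->
    framed_braid_rel (sigmaw i ++ sigmaw j ++ sigmaw i)
                     (sigmaw j ++ sigmaw i ++ sigmaw j)
| FrameComm (i j : 'I_n) :
    framed_braid_rel (framew i ++ framew j) (framew j ++ framew i)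
| FrameBraid (j : 'I_n) (i : 'I_n.-1) :
    framed_braid_rel (framew j ++ sigmaw i)
      (sigmaw i ++ framew (tperm (strand_l i) (strand_r i) j)).

Inductive modular_framed_rel (d : nat) : word fgen -> word fgen -> Prop :=
| ModularFramed u v : framed_braid_rel u v -> modular_framed_rel d u v
| ModularPow (j : 'I_n) : modular_framed_rel d (nseq d (inr j, false)) [::].

End FramedBraids.

Definition framed_braid (n : nat) : Type := pgroup (@framed_braid_rel n).
HB.instance Definition _ n := Group.on (framed_braid n).

Definition modular_framed_braid (d n : nat) : Type :=
  pgroup (@modular_framed_rel n d).
HB.instance Definition _ d n := Group.on (modular_framed_braid d n).

Section Shift.
Variables (k n N : nat) (le_N : k + n <= N).

Fact shift_sigma_subproof (i : 'I_n.-1) : k + i < N.-1.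
Proof.
by rewrite ltn_predRL -addnS; apply: leq_trans le_N; rewrite ltn_add2l -ltn_predRL.
Qed.

Fact shift_frame_subproof (j : 'I_n) : k + j < N.
Proof. by apply: leq_trans le_N; rewrite ltn_add2l. Qed.

Definition shift_sigma (i : 'I_n.-1) : 'I_N.-1 := Ordinal (shift_sigma_subproof i).
Definition shift_frame (j : 'I_n) : 'I_N := Ordinal (shift_frame_subproof j).

Definition shift_gen (x : fgen n) : fgen N :=
  match x with inl i => inl (shift_sigma i) | inr j => inr (shift_frame j) end.

Definition shift_word (w : word (fgen n)) : word (fgen N) :=
  [seq (shift_gen x.1, x.2) | x <- w].

Lemma shift_framed_rel u v :
  framed_braid_rel u v -> framed_braid_rel (shift_word u) (shift_word v).
Proof.
case=> [i j ij|i j ij|i j|j i].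
- by apply: (@BraidFar N (shift_sigma i) (shift_sigma j)); rewrite /= -addnS ltn_add2l.
- by apply: (@BraidNear N (shift_sigma i) (shift_sigma j)); rewrite /= -addnS ij.
- exact: (@FrameComm N (shift_frame i) (shift_frame j)).
have ->: shift_word (sigmaw i ++ framew (tperm (strand_l i) (strand_r i) j))
  = sigmaw (shift_sigma i) ++ framew (tperm (strand_l (shift_sigma i))
      (strand_r (shift_sigma i)) (shift_frame j)); last exact: FrameBraid.
rewrite /shift_word /=; congr [:: _; (inr _, _)].
have frame_inj : injective shift_frame.
  by move=> a b /(congr1 val) /= /addnI /val_inj.
rewrite [LHS](inj_tperm _ _ _ frame_inj); congr (tperm _ _ _); apply: val_inj => //=.
by rewrite addnS.
Qed.

Lemma shift_modular_rel d u v :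
  modular_framed_rel d u v -> modular_framed_rel d (shift_word u) (shift_word v).
Proof.
case=> [{}u {}v /shift_framed_rel|j]; first exact: ModularFramed.
by rewrite /shift_word map_nseq; apply: ModularPow.
Qed.

Definition shift_braid : framed_braid n -> framed_braid N :=
  pgroup_lift (fun x => pgen (@framed_braid_rel N) (shift_gen x)).

Definition shift_modular (d : nat) :
    modular_framed_braid d n -> modular_framed_braid d N :=
  pgroup_lift (fun x => pgen (@modular_framed_rel N d) (shift_gen x)).

Lemma word_eval_shift (rel : word (fgen N) -> word (fgen N) -> Prop) w :
  word_eval (fun x => pgen rel (shift_gen x)) w = pword rel (shift_word w).
Proof.
elim: w => [|[s b] w IHw]; first by rewrite /word_eval big_nil.
rewrite -cat1s word_eval_cat IHw /shift_word map_cat pwordM /word_eval big_seq1.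
by rewrite /letter_eval; case: b => //=; congr (_ * _)%g; apply: pinvE.
Qed.

Lemma shift_braid_word w :
  shift_braid (pword (@framed_braid_rel n) w) = pword (@framed_braid_rel N) (shift_word w).
Proof.
rewrite -word_eval_shift; apply: pgroup_lift_word => u v uv.
by rewrite !word_eval_shift; apply/pwordP/WordRel/shift_framed_rel.
Qed.

Lemma shift_modular_word d w :
  shift_modular (pword (@modular_framed_rel n d) w)
  = pword (@modular_framed_rel N d) (shift_word w).
Proof.
rewrite -word_eval_shift; apply: pgroup_lift_word => u v uv.
by rewrite !word_eval_shift; apply/pwordP/WordRel/shift_modular_rel.
Qed.

Lemma shift_braidM : {morph shift_braid : u v / (u * v)%g}.
Proof.
apply: pgroup_liftM => u v uv.
by rewrite !word_eval_shift; apply/pwordP/WordRel/shift_framed_rel.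
Qed.

Lemma shift_modularM d : {morph @shift_modular d : u v / (u * v)%g}.
Proof.
apply: pgroup_liftM => u v uv.
by rewrite !word_eval_shift; apply/pwordP/WordRel/shift_modular_rel.
Qed.

End Shift.

Fact connected_sum_subproof_l n m : 0 + n.+1 <= (n + m).+1.
Proof. by rewrite ltnS leq_addr. Qed.

Fact connected_sum_subproof_r n m : n + m.+1 <= (n + m).+1.
Proof. by rewrite addnS. Qed.

(* Framed braids on n+1 and m+1 strands give one on (n+1)+(m+1)-1 strands. *)
Definition connected_sum n m
    (alpha : framed_braid n.+1) (beta : framed_braid m.+1) :
    framed_braid (n + m).+1 :=
  (shift_braid (connected_sum_subproof_l n m) alpha
   * shift_braid (connected_sum_subproof_r n m) beta)%g.

Section YokonumaHecke.
Variables (K : fieldType) (d : nat) (q : K).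
Local Open Scope ring_scope.

Section FixedStrands.
Variable n : nat.
Local Notation sigma i := (pgen (@modular_framed_rel n d) (inl i)).
Local Notation t j := (pgen (@modular_framed_rel n d) (inr j)).
Local Notation CF := (galg K (modular_framed_braid d n)).

Definition e_elt (i : 'I_n.-1) : CF :=
  d%:R^-1 *: \sum_(1 <= s < d.+1)
    gbasis K (t (strand_l i) ^+ s * t (strand_r i) ^- s)%g.

Definition sigma_elt (i : 'I_n.-1) : CF := gbasis K (sigma i).

Definition hecke_rel (x : CF) : Prop :=
  exists i, x = sigma_elt i ^+ 2 - 1 - (q - q^-1) *: (e_elt i * sigma_elt i).

Definition Yokonuma : Type := qalg hecke_rel.
HB.instance Definition _ := GRing.PzRing.on Yokonuma.
HB.instance Definition _ := GRing.Lmodule.on Yokonuma.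

Definition gY (i : 'I_n.-1) : Yokonuma := qproj hecke_rel (gbasis K (sigma i)).
Definition tY (j : 'I_n) : Yokonuma := qproj hecke_rel (gbasis K (t j)).

Definition braid_modular : framed_braid n -> modular_framed_braid d n :=
  pgroup_lift (pgen (@modular_framed_rel n d)).

Definition braidY (alpha : framed_braid n) : Yokonuma :=
  qproj hecke_rel (gbasis K (braid_modular alpha)).

End FixedStrands.

Lemma braid_modular_word n w :
  @braid_modular n (pword (@framed_braid_rel n) w)
  = pword (@modular_framed_rel n d) w.
Proof.
have evalE v : word_eval (pgen (@modular_framed_rel n d)) v
    = pword (@modular_framed_rel n d) v.
  elim: v => [|[s b] v IHv]; first by rewrite /word_eval big_nil.
  rewrite -cat1s word_eval_cat IHv pwordM /word_eval big_seq1.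
  by rewrite /letter_eval; case: b => //=; congr (_ * _)%g; apply: pinvE.
rewrite -evalE; apply: pgroup_lift_word => u v uv.
by rewrite !evalE; apply/pwordP/WordRel/ModularFramed.
Qed.

Lemma braid_modularM n : {morph @braid_modular n : a b / (a * b)%g}.
Proof.
elim/pgroupP => u; elim/pgroupP => v.
by rewrite -pwordM !braid_modular_word pwordM.
Qed.

Lemma braidYM n : {morph @braidY n : a b / (a * b)%g >-> a * b}.
Proof. by move=> a b; rewrite /braidY braid_modularM gbasisM rmorphM. Qed.

Lemma braidY_sigma n i : @braidY n (pgen (@framed_braid_rel n) (inl i)) = gY i.
Proof. by rewrite /braidY braid_modular_word. Qed.

Lemma braidY_frame n j : @braidY n (pgen (@framed_braid_rel n) (inr j)) = tY j.
Proof. by rewrite /braidY braid_modular_word. Qed.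

Section Inclusion.
Variable n : nat.
Let le_n : (0 + n <= n.+1)%N := leqnSn n.

Definition incl_galg (x : galg K (modular_framed_braid d n)) :
    Yokonuma n.+1 :=
  qproj (@hecke_rel n.+1) (galg_map (@shift_modular _ _ _ le_n d) x).

Fact incl_galg_is_zmod_morphism : zmod_morphism incl_galg.
Proof. by move=> x y; rewrite /incl_galg !linearB. Qed.
HB.instance Definition _ := GRing.isZmodMorphism.Build _ _
  incl_galg incl_galg_is_zmod_morphism.

Lemma shift_modular_gen x :
  @shift_modular _ _ _ le_n d (pgen (@modular_framed_rel n d) x)
  = pgen (@modular_framed_rel n.+1 d) (shift_gen le_n x).
Proof. exact: shift_modular_word. Qed.

Lemma shift_modular1 : @shift_modular _ _ _ le_n d 1%g = 1%g.
Proof. exact: shift_modular_word. Qed.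

Lemma shift_modularX u s :
  @shift_modular _ _ _ le_n d (u ^+ s)%g = (@shift_modular _ _ _ le_n d u ^+ s)%g.
Proof.
by elim: s => [|s IHs]; rewrite ?shift_modular1 // !expgS shift_modularM IHs.
Qed.

Lemma shift_modularV u :
  @shift_modular _ _ _ le_n d (u^-1)%g = ((@shift_modular _ _ _ le_n d u)^-1)%g.
Proof.
by apply: (mulIg (@shift_modular _ _ _ le_n d u)); rewrite -shift_modularM !mulVg shift_modular1.
Qed.

Fact incl_galg_is_monoid_morphism : monoid_morphism incl_galg.
Proof.
split=> [|x y]; last first.
  by rewrite /incl_galg galg_mapM ?rmorphM //; apply: shift_modularM.
by rewrite /incl_galg -(gbasis1 K) galg_map_basis shift_modular1 gbasis1 rmorph1.
Qed.
HB.instance Definition _ := GRing.isMonoidMorphism.Build _ _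
  incl_galg incl_galg_is_monoid_morphism.

Lemma incl_galg_hecke x : hecke_rel x -> incl_galg x = 0.
Proof.
move=> [i ->]; pose M := galg_map (R := K) (@shift_modular _ _ _ le_n d).
have MM : {morph M : x y / x * y} by apply: galg_mapM; apply: shift_modularM.
have Msigma : M (sigma_elt i) = sigma_elt (shift_sigma le_n i).
  by rewrite /M galg_map_basis shift_modular_gen.
have strand_lE : shift_frame le_n (strand_l i) = strand_l (shift_sigma le_n i).
  exact: val_inj.
have strand_rE : shift_frame le_n (strand_r i) = strand_r (shift_sigma le_n i).
  exact: val_inj.
have Me : M (e_elt i) = e_elt (shift_sigma le_n i).
  rewrite /M linearZ linear_sum /=; congr (_ *: _); apply: eq_bigr => s _.
  rewrite galg_map_basis shift_modularM shift_modularV !shift_modularX.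
  by rewrite !shift_modular_gen /= strand_lE strand_rE.
have MB : {morph M : x y / x - y} by move=> x1 x2; rewrite /M linearB.
have MZ a : {morph M : x1 / a *: x1} by move=> x1; rewrite /M linearZ.
rewrite expr2 /incl_galg -/M !MB MZ !MM Me Msigma.
have -> : M 1 = 1 by rewrite -(gbasis1 K) /M galg_map_basis shift_modular1.
by rewrite -expr2 qproj_gen //; exists (shift_sigma le_n i).
Qed.

Definition inclY : Yokonuma n -> Yokonuma n.+1 := qlift incl_galg.

Lemma inclYE x : inclY (qproj (@hecke_rel n) x) = incl_galg x.
Proof. exact: (qliftE incl_galg_hecke). Qed.

Fact inclY_is_linear : linear inclY.
Proof.
move=> a; elim/qalgP=> x; elim/qalgP=> y.
by rewrite -linearP !inclYE /incl_galg !linearP.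
Qed.
HB.instance Definition _ := GRing.isLinear.Build K (Yokonuma n)
  (Yokonuma n.+1) _ inclY inclY_is_linear.

Fact inclY_is_monoid_morphism : monoid_morphism inclY.
Proof.
split=> [|x y]; first by rewrite -(rmorph1 (qproj (@hecke_rel n))) inclYE rmorph1.
elim/qalgP: x => x; elim/qalgP: y => y.
by rewrite -rmorphM !inclYE rmorphM.
Qed.
HB.instance Definition _ := GRing.isMonoidMorphism.Build (Yokonuma n)
  (Yokonuma n.+1) inclY inclY_is_monoid_morphism.

Lemma inclY_g i : inclY (gY i) = gY (shift_sigma le_n i).
Proof. by rewrite inclYE /incl_galg galg_map_basis shift_modular_gen. Qed.

Lemma inclY_t j : inclY (tY j) = tY (shift_frame le_n j).
Proof. by rewrite inclYE /incl_galg galg_map_basis shift_modular_gen. Qed.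

End Inclusion.

(* Variable 0 is z and variable s, for 0 < s < d, is x_s. *)
Notation trace_ring := {mpoly K[d.-1.+1]}.

(* The maps [tr n], compatible with the inclusions, are the restrictions of  *)
(* one map on the union of the algebras [Yokonuma n].                        *)
Record Juyumaya_trace (tr : forall n, {linear Yokonuma n -> trace_ring}) :
    Prop := JuyumayaTrace {
  trace_incl : forall n (a : Yokonuma n), tr n.+1 (inclY a) = tr n a;
  traceC : forall n (a b : Yokonuma n), tr n (a * b) = tr n (b * a);
  trace1 : forall n, tr n 1 = 1;
  trace_g : forall n (a : Yokonuma n.+1),
    tr n.+2 (inclY a * @gY n.+2 ord_max) = 'X_ord0 * tr n.+1 a;
  trace_t : forall n (a : Yokonuma n) (s : 'I_d.-1),
    tr n.+1 (inclY a * @tY n.+1 ord_max ^+ s.+1)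
    = 'X_(lift ord0 s) * tr n a }.

Definition specialize (x : nat -> K) (p : trace_ring) : {poly K} :=
  mpoly.mmap polyC (fun i : 'I_d.-1.+1 => if i == ord0 then 'X else (x i)%:P) p.

Definition specialized_trace (tr : forall n, {linear Yokonuma n -> trace_ring})
    (x : nat -> K) n (alpha : framed_braid n) : {poly K} :=
  specialize x (tr n (braidY alpha)).

Definition E_sum (x : nat -> K) (m : nat) : K :=
  d%:R^-1 * \sum_(0 <= s < d) x ((m + s) %% d)%N * x ((d - s) %% d)%N.

Definition E_system (x : nat -> K) : Prop :=
  x 0%N = 1 /\
  forall m, (1 <= m <= d.-1)%N -> E_sum x m = x m * E_sum x 0.

End YokonumaHecke.

Section ESystemSolution.
Variables (R : realType) (d : nat) (D : {set 'I_d}).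
Local Open Scope ring_scope.
Local Open Scope complex_scope.

(* exp(theta * sqrt(-1)) *)
Definition expi (theta : R) : R[i] := cos theta +i* sin theta.

Definition E_solution (k : nat) : R[i] :=
  #|D|%:R^-1 * \sum_(m in D) expi (2 * pi * k%:R * m%:R / d%:R).

Lemma expiD a b : expi (a + b) = expi a * expi b.
Proof.
by rewrite /expi cosD sinD; congr (_ +i* _); rewrite /= addrC.
Qed.

Lemma expi0 : expi 0 = 1.
Proof. by rewrite /expi cos0 sin0. Qed.

Lemma expiMn a n : expi (a *+ n) = expi a ^+ n.
Proof.
by elim: n => [|n IHn]; rewrite ?mulr0n ?expi0 ?expr0 // mulrS expiD IHn exprS.
Qed.

Lemma expi_2pi : expi (2 * pi) = 1.
Proof. by rewrite mulr_natl /expi cos2pi sin2pi. Qed.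

Lemma expi_neq1 k : (0 < k < d)%N -> expi (2 * pi * k%:R / d%:R) != 1.
Proof.
move=> /andP[k_gt0 lt_kd]; have d_gt0 : (0 < d)%N by apply: leq_trans lt_kd.
have dR_gt0 : 0 < d%:R :> R by rewrite ltr0n.
pose a : R := pi * k%:R / d%:R.
have sin_a : 0 < sin a.
  apply: sin_gt0_pi; rewrite divr_gt0 ?mulr_gt0 ?pi_gt0 ?ltr0n //=.
  by rewrite ltr_pdivrMr // ltr_pM2l ?pi_gt0 // ltr_nat.
have -> : 2 * pi * k%:R / d%:R = a *+ 2 by rewrite -[RHS]mulr_natl /a !mulrA.
apply/eqP => -[/eqP]; rewrite cos_mulr2n subr_eq -(mulr2n 1) eqrMn2r /= => /eqP c2.
have /eqP := cos2Dsin2 a; rewrite c2 addrC -subr_eq0 addrK sqrf_eq0.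
by rewrite (gt_eqF sin_a).
Qed.

(* The d-th root of unity of exponent m. *)
Definition root_expi (m : 'I_d) : R[i] := expi (2 * pi * m%:R / d%:R).

Lemma E_solutionE k :
  E_solution k = #|D|%:R^-1 * \sum_(m in D) root_expi m ^+ k.
Proof.
congr (_ * _); apply: eq_bigr => m _; rewrite -expiMn; congr expi.
by rewrite -[RHS]mulr_natr -!mulrA; do 2!congr (_ * _); rewrite [LHS]mulrC -mulrA.
Qed.

Hypothesis d_gt0 : (0 < d)%N.

Lemma root_expiX_d m : root_expi m ^+ d = 1.
Proof.
rewrite -expiMn -[X in expi X]mulr_natr divfK ?pnatr_eq0 -?lt0n //.
by rewrite mulr_natr expiMn expi_2pi expr1n.
Qed.

Lemma root_expi_neq0 m : root_expi m != 0.
Proof.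
apply/eqP => /(congr1 (fun z => z ^+ d))/eqP.
by rewrite root_expiX_d expr0n eqn0Ngt d_gt0 oner_eq0.
Qed.

Lemma root_expi_inj : injective root_expi.
Proof.
have H (a b : 'I_d) : (a < b)%N -> root_expi a != root_expi b.
  move=> ab; have := @expi_neq1 (b - a).
  rewrite subn_gt0 ab (leq_ltn_trans (leq_subr _ _)) // => /(_ isT).
  apply: contraNneq => eq_ab; apply/eqP/(mulfI (root_expi_neq0 a)).
  rewrite mulr1 [RHS]eq_ab -expiD -!mulrDl -mulrDr -natrD subnKC //.
  exact: ltnW.
move=> a b /eqP eq_ab; apply/val_inj/eqP; case: ltngtP => // /H.
  by rewrite eq_ab.
by rewrite eq_sym eq_ab.
Qed.

Lemma sum_root_expi (a b : 'I_d) :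
  \sum_(0 <= s < d) (root_expi a / root_expi b) ^+ s = d%:R *+ (a == b).
Proof.
have [->|neq_ab] := eqVneq a b.
  rewrite divff ?root_expi_neq0 // (eq_bigr (fun=> 1)) => [|s _]; last exact: expr1n.
  by rewrite sumr_const_nat subn0.
have u_neq1 : root_expi a / root_expi b - 1 != 0.
  rewrite subr_eq0 -(inj_eq (mulIf (root_expi_neq0 b))) mul1r divfK ?root_expi_neq0 //.
  by rewrite (inj_eq root_expi_inj).
apply: (mulfI u_neq1); rewrite mulr0 big_mkord -subrX1.
by rewrite expr_div_n !root_expiX_d divr1 subrr.
Qed.

Lemma E_solution_E_system : D != set0 -> E_system d E_solution.
Proof.
move=> D_neq0; pose c : R[i] := #|D|%:R.
have c_neq0 : c != 0 by rewrite pnatr_eq0 cards_eq0.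
have x_mod k : E_solution (k %% d) = E_solution k.
  rewrite !E_solutionE; congr (_ * _); apply: eq_bigr => m _.
  by rewrite expr_mod ?root_expiX_d.
have E_sumE m : E_sum d E_solution m = c^-1 * E_solution m.
  have termE s : (0 <= s < d)%N ->
      E_solution ((m + s) %% d) * E_solution ((d - s) %% d)
      = c^-1 * c^-1 * \sum_(a in D) \sum_(b in D)
          root_expi a ^+ m * (root_expi a / root_expi b) ^+ s.
    move=> /andP[_ lt_sd]; rewrite !x_mod !E_solutionE mulrACA; congr (_ * _).
    rewrite mulr_suml; apply: eq_bigr => a _; rewrite mulr_sumr.
    apply: eq_bigr => b _; rewrite exprD expr_div_n mulrA; congr (_ * _).
    apply: (mulIf (expf_neq0 s (root_expi_neq0 b))).
    by rewrite -exprD subnK ?(ltnW lt_sd) // root_expiX_d mulVf // expf_neq0 ?root_expi_neq0.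
  rewrite /E_sum (eq_big_nat _ _ termE) -mulr_sumr exchange_big /=.
  rewrite (eq_bigr (fun a => root_expi a ^+ m * d%:R)) => [|a aD].
    rewrite -mulr_suml E_solutionE -/c mulrCA [_ * d%:R]mulrC.
    by rewrite mulKf ?pnatr_eq0 -?lt0n // mulrA.
  rewrite exchange_big (bigD1 a) //= -mulr_sumr sum_root_expi eqxx.
  rewrite big1 ?addr0 // => b /andP[_ /negPf].
  by rewrite -mulr_sumr sum_root_expi eq_sym => ->; rewrite mulr0.
have x0 : E_solution 0 = 1.
  rewrite E_solutionE (eq_bigr (fun=> 1)) => [|a _]; last exact: expr0.
  by rewrite sumr_const mulVf.
by split=> // m _; rewrite !E_sumE x0 mulr1 mulrC.
Qed.

End ESystemSolution.

(* Main.v *)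
From HB Require Import structures.
Require Import Defs.
From mathcomp Require Import all_boot all_order all_algebra perm.
From mathcomp Require Import finmap mpoly monalg complex boolp reals trigo.

Set Implicit Arguments.
Unset Strict Implicit.
Unset Printing Implicit Defensive.

Import Order.TTheory GRing.Theory Num.Theory.
Local Open Scope ring_scope.

(** Write [T] for the specialized trace and [x_k] for the solution of the
    E-system, extended by [x_0 = x_d = 1].

    Necessity comes from braids on one strand. There the connected sum is the
    product, and [T (t_1 ^+ k) = x_k] for [0 <= k <= d], so multiplicativity of
    [T] forces [x_k = x_1 ^+ k] up to [k = d] (frame_multiplicative).

    For sufficiency, put [w = x_1]. The assumption says that a framing [t ^+ s]
    on a new strand always contributes the factor [w ^+ s], for every [s].
    The algebra on [n + 2] strands is spanned by the monomials [a t_(n+2)^s] and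
    [a g_(n+1) b], with [a] and [b] in the algebra on [n + 1] strands
    (markov_spanT): closure under the generators reduces to removing one of two
    last crossings, by the braid relation or by the quadratic relation. On these
    monomials the trace rules apply directly. First, [T (y t_n) = w T y] for
    every [y] on [n] strands, also when the last strand of [y] is entangled
    (markov_trace_last_frame): the framing slides through crossings, and
    cyclicity removes them. Next, for [a] and [b] sharing one strand,
    [T (a b) = T a * T b] by induction on the number of strands of [b]
    (markov_trace_connected_sum): the last framing or crossing of [b]
    contributes the same factor to both sides, until [b] is reduced to a framing
    of the shared strand, where the previous formula concludes.

    The position of [b] on the last strands is given by a morphism between
    algebras on different numbers of strands, induced by the shift of framed
    braids (shiftY); the natural inclusions are its instances with shift 0. *)

(** * Relations and generators of the Yokonuma--Hecke algebra *)

Lemma qproj_quadratic (K : comNzRingType) (A : algType K) (S : A -> Prop) s e c :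
    S (s ^+ 2 - 1 - c *: (e * s)) ->
  qproj S s * qproj S s = 1 + c *: (qproj S e * qproj S s).
Proof.
move/qproj_gen; rewrite !linearB linearZ expr2 !rmorphM rmorph1 -addrA -opprD.
exact: subr0_eq.
Qed.

Section Relations.
Variables (K : fieldType) (d : nat) (q : K) (n : nat).
Local Notation Y := (Yokonuma d q n).

Definition projY (x : galg K (modular_framed_braid d n)) : Y :=
  qproj (@hecke_rel K d q n) x.

Lemma projYM x y : projY (x * y) = projY x * projY y.
Proof. exact: (rmorphM (qproj (@hecke_rel K d q n))). Qed.
Lemma projYD x y : projY (x + y) = projY x + projY y.
Proof. exact: (rmorphD (qproj (@hecke_rel K d q n))). Qed.
Lemma projYZ c x : projY (c *: x) = c *: projY x.
Proof. by rewrite /projY linearZ. Qed.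
Lemma projY1 : projY 1 = 1.
Proof. exact: (rmorph1 (qproj (@hecke_rel K d q n))). Qed.
Lemma projY_sum I (r : seq I) (P : pred I) F :
  projY (\sum_(i <- r | P i) F i) = \sum_(i <- r | P i) projY (F i).
Proof. exact: (rmorph_sum (qproj (@hecke_rel K d q n))). Qed.

Definition basisY (g : modular_framed_braid d n) : Y := projY (gbasis K g).

Lemma basisYM g h : basisY (g * h)%g = basisY g * basisY h.
Proof. by rewrite /basisY (gbasisM K g h) projYM. Qed.

Lemma basisYX g s : basisY (g ^+ s)%g = basisY g ^+ s.
Proof.
elim: s => [|s IHs]; first exact: projY1.
by rewrite expgS (basisYM g) IHs [RHS]exprS.
Qed.

Definition wordY (w : word (fgen n)) : Y :=
  basisY (pword (@modular_framed_rel n d) w).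

Lemma wordY_cat u v : wordY (u ++ v) = wordY u * wordY v.
Proof. by rewrite /wordY pwordM basisYM. Qed.

Lemma wordY_nil : wordY [::] = 1.
Proof. exact: projY1. Qed.

Lemma wordY_rel u v : framed_braid_rel u v -> wordY u = wordY v.
Proof.
by move=> uv; congr (basisY _); apply/pwordP/WordRel/ModularFramed.
Qed.

Lemma gYE i : gY d q i = wordY (sigmaw i). Proof. by []. Qed.
Lemma tYE j : tY d q j = wordY (framew j). Proof. by []. Qed.

Lemma Yokonuma_scaleAl c (x y : Y) : c *: (x * y) = (c *: x) * y.
Proof. exact: qscaleAl. Qed.
Lemma Yokonuma_scaleAr c (x y : Y) : c *: (x * y) = x * (c *: y).
Proof. exact: qscaleAr. Qed.

Lemma Yokonuma_commZ c (x y : Y) : GRing.comm x y -> GRing.comm x (c *: y).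
Proof. by rewrite /GRing.comm -Yokonuma_scaleAr -Yokonuma_scaleAl => ->. Qed.

Lemma tYX_d j : (tY d q j : Y) ^+ d = 1.
Proof.
have tX e : (tY d q j : Y) ^+ e = wordY (nseq e (inr j, false)).
  elim: e => [|e IHe]; first by rewrite expr0 wordY_nil.
  by rewrite exprS IHe tYE -wordY_cat.
rewrite tX -wordY_nil; congr (basisY _); apply/pwordP/WordRel.
exact: ModularPow.
Qed.

Lemma tYC i j : GRing.comm (tY d q i : Y) (tY d q j).
Proof.
by rewrite /GRing.comm !tYE -!wordY_cat; apply: wordY_rel; apply: FrameComm.
Qed.

Lemma tYg j i : (tY d q j : Y) * gY d q i
  = gY d q i * tY d q (tperm (strand_l i) (strand_r i) j).
Proof.
by rewrite !tYE gYE -!wordY_cat; apply: wordY_rel; apply: FrameBraid.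
Qed.

Lemma gYC (i j : 'I_n.-1) :
  (i.+1 < j)%N -> GRing.comm (gY d q i : Y) (gY d q j).
Proof.
move=> ij; rewrite /GRing.comm !gYE -!wordY_cat.
by apply: wordY_rel; apply: BraidFar.
Qed.

Lemma gYbraid (i j : 'I_n.-1) : j = i.+1 :> nat ->
  (gY d q i : Y) * gY d q j * gY d q i = gY d q j * gY d q i * gY d q j.
Proof.
move=> ij; rewrite !gYE -!wordY_cat -!catA.
by apply: wordY_rel; apply: BraidNear.
Qed.

Definition eY (i : 'I_n.-1) : Y := projY (e_elt K d i).

Hypothesis d_gt0 : (0 < d)%N.

Lemma wordY_frameV j : wordY [:: (inr j, true)] = tY d q j ^+ d.-1.
Proof.
have tV : tY d q j * wordY [:: (inr j, true)] = 1.
  rewrite tYE -wordY_cat -wordY_nil; congr (basisY _).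
  by apply/pwordP; apply: (WordCancel _ _ false).
have Vt : (tY d q j : Y) ^+ d.-1 * tY d q j = 1.
  by rewrite -exprSr prednK // tYX_d.
by rewrite -[LHS]mul1r -Vt -mulrA tV mulr1.
Qed.

Lemma eYE i : eY i = d%:R^-1 *: \sum_(1 <= s < d.+1)
  (tY d q (strand_l i) ^+ s * (tY d q (strand_r i) ^+ d.-1) ^+ s).
Proof.
rewrite /eY /e_elt projYZ projY_sum; congr (_ *: _); apply: eq_bigr => s _.
rewrite -wordY_frameV -[LHS]/(basisY _) basisYM -expVgn.
rewrite (basisYX _ s) (basisYX (pgen _ _)^-1 s).
have -> : basisY (pgen (@modular_framed_rel n d) (inr (strand_r i)))^-1%g
   = wordY [:: (inr (strand_r i), true)]; last by [].
by rewrite /wordY; congr basisY; apply: pinvE.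
Qed.

Lemma gY_sqr i : gY d q i * gY d q i = 1 + (q - q^-1) *: (eY i * gY d q i).
Proof. by apply: qproj_quadratic; exists i. Qed.

(** Multiplying the quadratic relation by the inverse of [g_i] gives the inverse
    as [g_i - (q - q^-1) e_i], so inverse letters add nothing to the algebra
    generated by the [g_i] and the [t_j]. *)
Lemma wordY_sigmaV i : wordY [:: (inl i, true)] = gY d q i - (q - q^-1) *: eY i.
Proof.
have gV : gY d q i * wordY [:: (inl i, true)] = 1.
  rewrite gYE -wordY_cat -wordY_nil; congr (basisY _).
  by apply/pwordP; apply: (WordCancel _ _ false).
set V := wordY _ in gV *.
have : gY d q i * gY d q i * V = (1 + (q - q^-1) *: (eY i * gY d q i)) * V.
  by rewrite gY_sqr.
rewrite -mulrA gV mulr1 mulrDl mul1r -Yokonuma_scaleAl -mulrA gV mulr1 => ->.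
exact: esym (addrK _ _).
Qed.

(** The algebra is generated by the [g_i] and the [t_j]: it is the span of the
    images of words, and an inverse letter is a polynomial in these generators.
    Hence a linear condition that holds at 1 and survives right multiplication
    by a generator holds everywhere. *)
Lemma Yokonuma_ind (P : Y -> Prop) :
    (forall c x y, P x -> P y -> P (c *: x + y)) -> P 1 ->
    (forall x i, P x -> P (x * gY d q i)) ->
    (forall x j, P x -> P (x * tY d q j)) ->
  forall x, P x.
Proof.
move=> PZD P1 Pg Pt.
have P0 : P 0 by have := PZD (-1) 1 1 P1 P1; rewrite scaleN1r addNr.
have PD x y : P x -> P y -> P (x + y).
  by move=> Px; rewrite -[x]scale1r; apply: PZD.
have PZ c x : P x -> P (c *: x).
  by move=> Px; rewrite -[_ *: _]addr0; apply: PZD.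
have PtX x j s : P x -> P (x * tY d q j ^+ s).
  move=> Px; elim: s => [|s IHs]; first by rewrite mulr1.
  by rewrite exprSr mulrA; apply: Pt.
have Pe x i : P x -> P (x * eY i).
  move=> Px; rewrite eYE -Yokonuma_scaleAr mulr_sumr; apply: PZ.
  by apply: big_ind => // s _; rewrite mulrA -exprM; apply/PtX/PtX.
have Pword w : P (wordY w).
  elim/last_ind: w => [|w [[i|j] b] IHw]; first by rewrite wordY_nil.
  - rewrite -cats1 wordY_cat; case: b; last exact: Pg.
    rewrite wordY_sigmaV mulrBr -Yokonuma_scaleAr -scaleNr addrC.
    by apply: PZD; [apply: Pe|apply: Pg].
  - rewrite -cats1 wordY_cat; case: b; last exact: Pt.
    by rewrite wordY_frameV; apply: PtX.
elim/qalgP; elim/galg_ind => [|x y Px Py|c g].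
- by rewrite linear0.
- by rewrite linearD; apply: PD.
- rewrite -galg_scaleU linearZ; apply: PZ.
  by elim/pgroupP: g => w; apply: Pword.
Qed.

End Relations.

(** * Shifting strands *)

Lemma linear_quadratic (K : fieldType) (A : algType K) d (q : K) n
    (f : {linear A -> Yokonuma d q n}) (fM : monoid_morphism f) s e c :
  f (s ^+ 2 - 1 - c *: (e * s)) = f s * f s - 1 - c *: (f e * f s).
Proof. by rewrite !linearB linearZ expr2 !fM.2 fM.1. Qed.

Section Shift.
Variables (K : fieldType) (d : nat) (q : K).
Variables (k n N : nat) (le_N : (k + n <= N)%N).
Local Notation Y := (Yokonuma d q N).
Local Notation shift := (@shift_modular k n N le_N d).
Local Notation CF := (galg K (modular_framed_braid d n)).

HB.instance Definition _ := monoid.isMultiplicative.Build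
  (modular_framed_braid d n) (modular_framed_braid d N) shift
  (@shift_modularM k n N le_N d).

Fact shift_modular_eq1 : shift 1%g = 1%g.
Proof. exact: shift_modular_word. Qed.

HB.instance Definition _ := monoid.Multiplicative_isUMagmaMorphism.Build
  (modular_framed_braid d n) (modular_framed_braid d N) shift shift_modular_eq1.

Definition shift_galg (x : CF) : Y := projY q (galg_map shift x).

Fact shift_galg_is_linear : linear shift_galg.
Proof. by move=> a x y; rewrite /shift_galg /projY !linearP. Qed.
HB.instance Definition _ :=
  GRing.isLinear.Build K CF Y _ shift_galg shift_galg_is_linear.

Lemma shift_galg_basis u : shift_galg (gbasis K u) = basisY q (shift u).
Proof. by rewrite /shift_galg galg_map_basis. Qed.

Fact shift_galg_is_monoid_morphism : monoid_morphism shift_galg.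
Proof.
split=> [|x y].
  by rewrite -gbasis1 shift_galg_basis shift_modular_eq1 /basisY gbasis1 projY1.
by rewrite /shift_galg galg_mapM ?projYM //; apply: shift_modularM.
Qed.
HB.instance Definition _ := GRing.isMonoidMorphism.Build CF Y
  shift_galg shift_galg_is_monoid_morphism.

Lemma shift_galg_gen x :
  shift_galg (gbasis K (pgen (@modular_framed_rel n d) x))
  = basisY q (pgen (@modular_framed_rel N d) (shift_gen le_N x)).
Proof. by rewrite shift_galg_basis shift_modular_word. Qed.

Lemma shift_galg_e i : shift_galg (e_elt K d i) = eY d q (shift_sigma le_N i).
Proof.
have lE : shift_frame le_N (strand_l i) = strand_l (shift_sigma le_N i).
  exact: val_inj.
have rE : shift_frame le_N (strand_r i) = strand_r (shift_sigma le_N i).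
  by apply: val_inj; rewrite /= addnS.
rewrite /eY /e_elt linearZ linear_sum projYZ projY_sum /=.
congr (_ *: _); apply: eq_bigr => s _; rewrite shift_galg_basis.
rewrite -[RHS]/(basisY q _); congr (basisY q _).
have shiftE a b : shift (a ^+ s * b ^- s)%g = (shift a ^+ s * shift b ^- s)%g.
  by rewrite gmulfM gmulfXVn gmulfXn.
rewrite shiftE -lE -rE; congr (_ ^+ _ * _ ^- _)%g; exact: shift_modular_word.
Qed.

(** Shifting sends the relation at [i] to the relation at [k + i], so the
    shift of framed braids descends to the Yokonuma--Hecke algebras. *)
Lemma shift_galg_hecke x : hecke_rel q x -> shift_galg x = 0.
Proof.
move=> [i ->]; rewrite (linear_quadratic shift_galg_is_monoid_morphism) /=.
rewrite shift_galg_e /sigma_elt shift_galg_gen.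
by rewrite -[basisY _ _]/(gY d q _) gY_sqr -addrA -opprD subrr.
Qed.

Definition shiftY : Yokonuma d q n -> Y := qlift shift_galg.

Lemma shiftY_proj x : shiftY (projY q x) = shift_galg x.
Proof. exact: (qliftE shift_galg_hecke). Qed.

Lemma shiftYP c x y : shiftY (c *: x + y) = c *: shiftY x + shiftY y.
Proof.
elim/qalgP: x => x; elim/qalgP: y => y; rewrite -![qproj _ _]/(projY q _).
by rewrite -projYZ -projYD !shiftY_proj linearP.
Qed.

Lemma shiftY1 : shiftY 1 = 1.
Proof. by rewrite -projY1 shiftY_proj rmorph1. Qed.

Lemma shiftYM x y : shiftY (x * y) = shiftY x * shiftY y.
Proof.
elim/qalgP: x => x; elim/qalgP: y => y; rewrite -![qproj _ _]/(projY q _).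
by rewrite -projYM !shiftY_proj rmorphM.
Qed.

Lemma shiftYX x s : shiftY (x ^+ s) = shiftY x ^+ s.
Proof.
by elim: s => [|s IHs]; [exact: shiftY1 | rewrite !exprS shiftYM IHs].
Qed.

Lemma shiftY_g i : shiftY (gY d q i) = gY d q (shift_sigma le_N i).
Proof. by rewrite shiftY_proj shift_galg_gen. Qed.

Lemma shiftY_t j : shiftY (tY d q j) = tY d q (shift_frame le_N j).
Proof. by rewrite shiftY_proj shift_galg_gen. Qed.

Lemma braidY_shift (alpha : framed_braid n) :
  braidY d q (shift_braid le_N alpha) = shiftY (braidY d q alpha).
Proof.
elim/pgroupP: alpha => w; rewrite shift_braid_word.
rewrite /braidY !braid_modular_word shiftY_proj shift_galg_basis.
by rewrite shift_modular_word.
Qed.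

End Shift.

Section ShiftFunctoriality.
Variables (K : fieldType) (d : nat) (q : K) (d_gt0 : (0 < d)%N).

Lemma inclY_shift n (x : Yokonuma d q n) :
  inclY x = shiftY (leqnSn n : (0 + n <= n.+1)%N) x.
Proof. by []. Qed.

Lemma shiftY_id n (le_n : (0 + n <= n)%N) (x : Yokonuma d q n) :
  shiftY le_n x = x.
Proof.
elim/(@Yokonuma_ind K d q n d_gt0): x => [c x y IHx IHy||x i IHx|x j IHx].
- by rewrite shiftYP IHx IHy.
- exact: shiftY1.
- rewrite shiftYM IHx shiftY_g; congr (_ * gY d q _); exact: val_inj.
- rewrite shiftYM IHx shiftY_t; congr (_ * tY d q _); exact: val_inj.
Qed.

Lemma shiftY_comp k k' n n' N (le_n' : (k + n <= n')%N)
    (le_N : (k' + n' <= N)%N) (le_nN : (k' + k + n <= N)%N)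
    (x : Yokonuma d q n) :
  shiftY le_N (shiftY le_n' x) = shiftY le_nN x.
Proof.
elim/(@Yokonuma_ind K d q n d_gt0): x => [c x y IHx IHy||x i IHx|x j IHx].
- rewrite (shiftYP le_n') (shiftYP le_N) shiftYP.
  by apply: congr2 IHy; rewrite IHx.
- by rewrite !shiftY1.
- rewrite (shiftYM le_n') (shiftYM le_N) shiftYM; apply: congr2 IHx _.
  rewrite !shiftY_g; congr (gY d q _).
  by apply: val_inj; rewrite /= addnA.
- rewrite (shiftYM le_n') (shiftYM le_N) shiftYM; apply: congr2 IHx _.
  rewrite !shiftY_t; congr (tY d q _).
  by apply: val_inj; rewrite /= addnA.
Qed.

(** Commuting with the images of the generators suffices, as the shift is a
    morphism of algebras. *)
Lemma shiftY_comm k n N (le_N : (k + n <= N)%N) (a : Yokonuma d q N) :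
    (forall i, GRing.comm a (gY d q (shift_sigma le_N i))) ->
    (forall j, GRing.comm a (tY d q (shift_frame le_N j))) ->
  forall x, GRing.comm a (shiftY le_N x).
Proof.
move=> ag at_.
elim/(@Yokonuma_ind K d q n d_gt0) => [c x y ax ay||x i ax|x j ax].
- rewrite shiftYP; exact: commrD (Yokonuma_commZ c ax) ay.
- rewrite shiftY1; exact: commr1.
- rewrite shiftYM shiftY_g; exact: commrM ax (ag i).
- rewrite shiftYM shiftY_t; exact: commrM ax (at_ j).
Qed.

End ShiftFunctoriality.

(** * The span of the Markov monomials *)

Lemma exchangeX (A : pzRingType) (x g y : A) s :
  x * g = g * y -> x ^+ s * g = g * y ^+ s.
Proof.
move=> xg; elim: s => [|s IHs]; first by rewrite mul1r mulr1.
by rewrite exprSr -mulrA xg mulrA IHs -mulrA -exprSr.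
Qed.

(** A framing on the last strand slides through the last crossing; [c] is
    supported away from the last strand. *)
Lemma cross_slide (A : pzRingType) (b g c t u : A) :
  t * c = c * t -> u * g = g * t -> b * g * c * t = b * u * g * c.
Proof. by move=> tc ug; rewrite -mulrA -tc -!mulrA (mulrA u) ug !mulrA. Qed.

(** The shape of one summand of [t ^+ s * (e * g)]: [u] and [w] are powers of
    the last framing, [v] a power of the framing of the previous strand. *)
Lemma commute_slide (A : pzRingType) (u v w x g : A) :
  u * v = v * u -> (u * w) * g = g * x -> u * (v * w * g) = v * g * x.
Proof. by move=> uv uwg; rewrite !mulrA uv -!mulrA -uwg !mulrA. Qed.

(** For [c] supported away from both strands of the crossing [g], and [u], [v]
    the framings of these two strands. *)
Lemma sandwich_slide (A : pzRingType) (g c u v : A) :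
  g * c = c * g -> g * u = v * g -> g * (c * u) * g = c * (v * (g * g)).
Proof. by move=> gc gu; rewrite mulrA gc -(mulrA c) gu !mulrA. Qed.

(** A crossing [h] caught between two crossings [g] is freed by the braid
    relation, once [c] and [c'], which live away from [g], are moved out. *)
Lemma braid_slide (A A' : pzRingType) (f : A' -> A) (g : A) (h c c' : A') :
    {morph f : x y / x * y} ->
    g * f c = f c * g -> g * f c' = f c' * g -> g * f h * g = f h * g * f h ->
  g * f (c * h * c') * g = f (c * h) * g * f (h * c').
Proof.
move=> fM gc gc' ghg; rewrite !fM !mulrA gc -(mulrA _ (f c')) -gc'.
by rewrite !mulrA -(mulrA (f c) g) -(mulrA (f c)) ghg !mulrA.
Qed.

Lemma mulr_tail (A : pzRingType) (x u v w : A) : u * v = w -> x * u * v = x * w.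
Proof. by move=> <-; rewrite mulrA. Qed.

Section Spanning.
Variables (K : fieldType) (d : nat) (q : K) (d_gt0 : (0 < d)%N).
Local Notation Y n := (Yokonuma d q n).
Local Notation g n := (@gY K d q n.+2 ord_max).
Local Notation t n := (@tY K d q n.+1 ord_max).

Lemma inclYM n (x y : Y n) : inclY (x * y) = inclY x * inclY y.
Proof. exact: rmorphM. Qed.

Lemma inclY1 n : inclY (1 : Y n) = 1.
Proof. exact: rmorph1. Qed.

Lemma inclYX n (x : Y n) s : inclY (x ^+ s) = inclY x ^+ s.
Proof. exact: rmorphXn. Qed.

Lemma inclYP n c (x y : Y n) : inclY (c *: x + y) = c *: inclY x + inclY y.
Proof. exact: linearP. Qed.

Lemma t_comm n (a : Y n) : GRing.comm (t n) (inclY a).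
Proof.
rewrite inclY_shift; apply: shiftY_comm; first by []; last first.
  by move=> j; apply: tYC.
move=> i; rewrite /GRing.comm tYg; congr (_ * _); congr (tY d q _).
have lt_in : (i.+1 < n)%N by rewrite -ltn_predRL.
by rewrite tpermD // -val_eqE /= ltn_eqF ?(ltnW lt_in).
Qed.

Lemma g_comm n (a : Y n) : GRing.comm (g n) (inclY (inclY a)).
Proof.
have le_n : (0 + n <= n.+2)%N by rewrite leqW.
rewrite 2!inclY_shift (shiftY_comp d_gt0 _ _ (le_n : (0 + 0 + n <= n.+2)%N)).
apply: shiftY_comm; first by [].
  move=> i; apply/commr_sym/gYC.
  have lt_in : (i.+1 < n)%N by rewrite -ltn_predRL.
  exact: lt_in.
move=> j; apply: commr_sym; rewrite /GRing.comm tYg; congr (_ * _).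
congr (tY d q _).
have lt_jn := ltn_ord j.
by rewrite tpermD // -val_eqE /= gtn_eqF //; apply: leqW.
Qed.

Lemma t_g n : t n.+1 * g n = g n * inclY (t n).
Proof.
rewrite tYg inclY_t; congr (_ * _); congr (tY d q _).
rewrite [X in tperm _ X _](_ : _ = ord_max) ?tpermR; exact: val_inj.
Qed.

Lemma tincl_g n : inclY (t n) * g n = g n * t n.+1.
Proof.
rewrite inclY_t tYg; congr (_ * _); congr (tY d q _).
pose f := shift_frame (leqnSn n.+1 : (0 + n.+1 <= n.+2)%N) ord_max.
rewrite [X in tperm X _ _](_ : _ = f).
  by rewrite tpermL; apply: val_inj.
exact: val_inj.
Qed.

Lemma tX_g n s : t n.+1 ^+ s * g n = g n * inclY (t n ^+ s).
Proof. by rewrite inclYX; apply/exchangeX/t_g. Qed.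

Lemma g_braid n :
  g n.+1 * inclY (g n) * g n.+1 = inclY (g n) * g n.+1 * inclY (g n).
Proof. by rewrite inclY_g; apply/esym/gYbraid. Qed.

(** The monomials on which the rules of a Markov trace can be applied at once:
    the last strand carries a framing only, or takes part in one crossing. *)
Inductive markov_span n : Y n.+2 -> Prop :=
| MarkovLin (c : K) x y :
    markov_span x -> markov_span y -> markov_span (c *: x + y)
| MarkovFrame a s : markov_span (inclY a * t n.+1 ^+ s)
| MarkovCross a b : markov_span (inclY a * g n * inclY b).

Section MarkovSpan.
Variable n : nat.
Local Notation span := (@markov_span n).

Lemma markov_span0 : span 0.
Proof.
have s1 : span (inclY 1 * t n.+1 ^+ 0) by apply: MarkovFrame.
by have := MarkovLin (-1) s1 s1; rewrite scaleN1r addNr.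
Qed.

Lemma markov_spanD x y : span x -> span y -> span (x + y).
Proof. by move=> sx sy; rewrite -[x]scale1r; apply: MarkovLin. Qed.

Lemma markov_spanZ c x : span x -> span (c *: x).
Proof.
by move=> sx; rewrite -[_ *: _]addr0; apply: MarkovLin sx markov_span0.
Qed.

Lemma markov_spanMl a x : span x -> span (inclY a * x).
Proof.
elim=> [c {}x y _ IHx _ IHy|b s|b c].
- by rewrite mulrDr -Yokonuma_scaleAr; apply: MarkovLin.
- by rewrite mulrA -inclYM; apply: MarkovFrame.
- by rewrite !mulrA -inclYM; apply: MarkovCross.
Qed.

Lemma markov_spanMr a x : span x -> span (x * inclY a).
Proof.
elim=> [c {}x y _ IHx _ IHy|b s|b c].
- by rewrite mulrDl -Yokonuma_scaleAl; apply: MarkovLin.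
- rewrite -mulrA (commr_sym (commrX s (commr_sym (t_comm a)))).
  by rewrite mulrA -inclYM; apply: MarkovFrame.
- by rewrite (mulr_tail _ (esym (inclYM c a))); apply: MarkovCross.
Qed.

Lemma markov_spanMt x : span x -> span (x * t n.+1).
Proof.
elim=> [c {}x y _ IHx _ IHy|b s|b c].
- by rewrite mulrDl -Yokonuma_scaleAl; apply: MarkovLin.
- by rewrite -mulrA -exprSr; apply: MarkovFrame.
- rewrite (cross_slide _ (t_comm c) (tincl_g n)) -(inclYM b (t n)).
  exact: MarkovCross.
Qed.

Lemma strand_l_max : strand_l (ord_max : 'I_n.+2.-1)
  = shift_frame (leqnSn n.+1 : (0 + n.+1 <= n.+2)%N) ord_max.
Proof. exact: val_inj. Qed.

Lemma strand_r_max : strand_r (ord_max : 'I_n.+2.-1) = ord_max.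
Proof. exact: val_inj. Qed.

(** The quadratic relation removes the double crossing; the correction
    [e * g] is a sum of framings, and each term becomes a single crossing by
    sliding the last framing through [g]. *)
Lemma markov_span_crossing2 s : span (t n.+1 ^+ s * (g n * g n)).
Proof.
rewrite gY_sqr // mulrDr mulr1; apply: markov_spanD.
  by rewrite -[t n.+1 ^+ s]mul1r -inclY1; apply: MarkovFrame.
rewrite -Yokonuma_scaleAr; apply: markov_spanZ; rewrite eYE //.
rewrite -Yokonuma_scaleAl -Yokonuma_scaleAr; apply: markov_spanZ.
rewrite mulr_suml mulr_sumr; apply: big_ind => [||r _].
- exact: markov_span0.
- exact: markov_spanD.
rewrite strand_l_max strand_r_max -inclY_t -inclYX -(exprM (t n.+1)).
have tt : t n.+1 ^+ s * inclY (t n ^+ r) = inclY (t n ^+ r) * t n.+1 ^+ s.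
  exact: commr_sym (commrX s (commr_sym (t_comm (t n ^+ r)))).
have tg : t n.+1 ^+ s * t n.+1 ^+ (d.-1 * r) * g n
    = g n * inclY (t n ^+ (s + d.-1 * r)) by rewrite -exprD; apply: tX_g.
rewrite (commute_slide tt tg).
exact: MarkovCross.
Qed.

Lemma markov_spanMg :
  (forall b, span (g n * inclY b * g n)) -> forall x, span x -> span (x * g n).
Proof.
move=> sandwich x; elim=> [c {}x y _ IHx _ IHy|b s|b c].
- by rewrite mulrDl -Yokonuma_scaleAl; apply: MarkovLin.
- by rewrite -mulrA tX_g mulrA; apply: MarkovCross.
- by rewrite -!mulrA; apply: markov_spanMl; rewrite mulrA.
Qed.

(** The span is closed under right multiplication by every generator, the only
    obstacle being two last crossings with an element [b] of the previous
    algebra between them. *)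
Lemma markov_span_all :
  (forall b, span (g n * inclY b * g n)) -> forall x, span x.
Proof.
move=> sandwich.
elim/(@Yokonuma_ind K d q n.+2 d_gt0) => [c x y||x i sx|x j sx].
- exact: MarkovLin.
- by rewrite -[1]mulr1 -[X in X * _]inclY1; apply: (MarkovFrame 1 0).
- have [->|neq_i] := eqVneq i (ord_max : 'I_n.+1); first exact: markov_spanMg.
  have lt_in : (i < n)%N by rewrite ltn_neqAle -ltnS ltn_ord andbT.
  have -> : gY d q i = inclY (gY d q (Ordinal lt_in : 'I_n.+1.-1)).
    by rewrite inclY_g; congr (gY d q _); apply: val_inj.
  exact: markov_spanMr.
- have [->|neq_j] := eqVneq j ord_max; first exact: markov_spanMt.
  have lt_jn : (j < n.+1)%N by rewrite ltn_neqAle -ltnS ltn_ord andbT.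
  have -> : tY d q j = inclY (tY d q (Ordinal lt_jn)).
    by rewrite inclY_t; congr (tY d q _); apply: val_inj.
  exact: markov_spanMr.
Qed.

Lemma markov_span_sandwich_lin c (x y : Y n.+1) :
    span (g n * inclY x * g n) -> span (g n * inclY y * g n) ->
  span (g n * inclY (c *: x + y) * g n).
Proof.
move=> sx sy; rewrite inclYP mulrDr mulrDl.
by rewrite -Yokonuma_scaleAr -Yokonuma_scaleAl; apply: MarkovLin.
Qed.

(** The case where [b] has no crossing on its last strand: it slides out, and
    the two crossings [g] meet. *)
Lemma markov_span_sandwich_frame (a : Y n) s :
  span (g n * inclY (inclY a * t n ^+ s) * g n).
Proof.
rewrite inclYM (sandwich_slide (g_comm a) (esym (tX_g n s))).
exact/markov_spanMl/markov_span_crossing2.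
Qed.

End MarkovSpan.

Lemma Yokonuma1_ind (P : Y 1 -> Prop) :
    (forall c x y, P x -> P y -> P (c *: x + y)) ->
    (forall s, P (t 0 ^+ s)) ->
  forall x, P x.
Proof.
move=> PZD Pt x.
suff: forall s, P (x * t 0 ^+ s) by move/(_ 0); rewrite mulr1.
elim/(@Yokonuma_ind K d q 1 d_gt0): x => [c x y IHx IHy s|s|x i|x j IHx s].
- by rewrite mulrDl -Yokonuma_scaleAl; apply: PZD.
- by rewrite mul1r.
- by exfalso; case: i.
- have -> : j = ord_max by rewrite (ord1 j) (ord1 ord_max).
  by rewrite -mulrA -exprS.
Qed.

(** Induction on the number of strands: [b] is itself in the span one level
    below, so at most one crossing separates the two crossings [g]. *)
Lemma markov_spanT n (x : Y n.+2) : markov_span x.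
Proof.
elim: n x => [|n IHn]; apply: markov_span_all => b.
  elim/Yokonuma1_ind: b => [c x y IHx IHy|s].
    exact: markov_span_sandwich_lin.
  by have := @markov_span_sandwich_frame 0 1 s; rewrite inclY1 mul1r.
elim: {b}(IHn b) => [c x y _ IHx _ IHy|a s|a b].
- exact: markov_span_sandwich_lin.
- exact: markov_span_sandwich_frame.
- rewrite (braid_slide (@inclYM n.+2) (g_comm a) (g_comm b) (g_braid n)).
  exact: MarkovCross.
Qed.

End Spanning.

(** Disposes of linear combinations in the inductions on spanning monomials
    below, where [h] is a scaling or a multiplication. *)
Lemma intertwine_linear (K : pzRingType) (V V' W W' : lmodType K)
    (f : V -> V') (h : W -> W') (S : V -> W) (S' : V' -> W') :
    linear f -> linear h -> linear S -> linear S' ->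
  forall c x y, S' (f x) = h (S x) -> S' (f y) = h (S y) ->
    S' (f (c *: x + y)) = h (S (c *: x + y)).
Proof. by move=> fL hL SL S'L c x y Sx Sy; rewrite fL S'L Sx Sy SL hL. Qed.

Lemma YokonumaMr_linear (K : fieldType) d (q : K) n (x : Yokonuma d q n) :
  linear (fun y : Yokonuma d q n => y * x).
Proof. by move=> c u v; rewrite mulrDl -Yokonuma_scaleAl. Qed.

Lemma YokonumaMl_linear (K : fieldType) d (q : K) n (x : Yokonuma d q n) :
  linear (fun y : Yokonuma d q n => x * y).
Proof. by move=> c u v; rewrite mulrDr -Yokonuma_scaleAr. Qed.

(** * Markov traces for which every framing has a fixed weight *)

Section Trace.
Variables (K : fieldType) (d : nat) (q : K) (d_gt0 : (0 < d)%N).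
Local Notation Y n := (Yokonuma d q n).
Local Notation g n := (@gY K d q n.+2 ord_max).
Local Notation t n := (@tY K d q n.+1 ord_max).
Variables (B : comAlgType K) (T : forall n, Y n -> B) (z : B) (w : K).
Hypothesis T_lin : forall n, linear (@T n).
Hypothesis TC : forall n (x y : Y n), T (x * y) = T (y * x).
Hypothesis T1 : forall n, T (1 : Y n) = 1.
Hypothesis T_g : forall n (x : Y n.+1), T (inclY x * g n) = z * T x.
Hypothesis T_t : forall n (x : Y n) s, T (inclY x * t n ^+ s) = w ^+ s *: T x.

Lemma markov_trace_frameX n s : T (t n ^+ s) = w ^+ s *: 1.
Proof. by rewrite -[t n ^+ s]mul1r -inclY1 T_t T1. Qed.

(** The trace property brings [b] in front of the crossing. *)
Lemma markov_trace_cross n (a b : Y n.+1) :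
  T (inclY a * g n * inclY b) = z * T (b * a).
Proof. by rewrite TC mulrA -(inclYM b a) T_g. Qed.

(** The rule for a new strand extends to the last strand of any braid: when
    that strand takes part in a crossing, its framing slides through to the
    previous strand, and the crossing is removed by the trace. Where
    there is no crossing, [w * w ^+ s = w ^+ s.+1] concludes. *)
Lemma markov_trace_last_frame n (x : Y n.+1) : T (x * t n) = w *: T x.
Proof.
have lin m (u v : Y m.+1) c :
    T (u * t m) = w *: T u -> T (v * t m) = w *: T v ->
    T ((c *: u + v) * t m) = w *: T (c *: u + v).
  apply: (intertwine_linear (YokonumaMr_linear (t m)) _ (@T_lin _) (@T_lin _)).
  by move=> e r p; rewrite scalerDr !scalerA mulrC.
elim: n x => [|n IHn] x.
  elim/(@Yokonuma1_ind K d q d_gt0): x => [c u v|s]; first exact: lin.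
  by rewrite -exprSr !markov_trace_frameX scalerA -exprS.
elim: {x}(markov_spanT d_gt0 x) => [c u v _ Tu _ Tv|a s|a b].
- exact: lin.
- rewrite -mulrA -exprSr; apply: etrans (T_t a s.+1) _.
  by rewrite (T_t a s) scalerA -exprS.
- have slide := cross_slide (inclY a) (t_comm d_gt0 b) (@tincl_g K d q n).
  apply: etrans (congr1 (@T _) slide) _; rewrite -(inclYM a (t n)).
  apply: etrans (markov_trace_cross _ _) _.
  by rewrite mulrA IHn (markov_trace_cross a b) scalerAr.
Qed.

Lemma markov_trace_last_frameX n (x : Y n.+1) s :
  T (x * t n ^+ s) = w ^+ s *: T x.
Proof.
elim: s => [|s IHs]; first by rewrite mulr1 scale1r.
by rewrite exprSr mulrA markov_trace_last_frame IHs scalerA -exprS.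
Qed.

Lemma shiftY_inclr k n N (le_n : (k + n <= N)%N) (le_n1 : (k + n.+1 <= N.+1)%N)
    (x : Y n) : shiftY le_n1 (inclY x) = inclY (shiftY le_n x).
Proof.
rewrite !inclY_shift.
have le1 : (k + 0 + n <= N.+1)%N by rewrite addn0 leqW.
have le2 : (0 + k + n <= N.+1)%N by rewrite leqW.
rewrite (shiftY_comp d_gt0 _ _ le1) (shiftY_comp d_gt0 _ _ le2).
by move: (le1); rewrite addn0 => le3; rewrite (bool_irrelevance le3 le2).
Qed.

(** Induction on the strands of [b]: a last framing or a last crossing of [b]
    is removed by the same rule in the product and in the trace of [b] alone.
    When one strand is left, [b] is a framing of the strand shared with [a]. *)
Lemma markov_trace_connected_sum m n N (le_a : (0 + n.+1 <= N.+1)%N)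
    (le_b : (n + m.+1 <= N.+1)%N) (a : Y n.+1) (b : Y m.+1) : N = (n + m)%N ->
  T (shiftY le_a a * shiftY le_b b) = T a * T b.
Proof.
have lin N' M (u : Y N') (f : Y M -> Y N') (x y : Y M) c :
    linear f -> T (u * f x) = T a * T x -> T (u * f y) = T a * T y ->
    T (u * f (c *: x + y)) = T a * T (c *: x + y).
  move=> fL; pose f' x' := u * f x'; pose h r := T a * r.
  have f'L : linear f' by move=> e r p; rewrite /f' fL (YokonumaMl_linear u).
  have hL : linear h by move=> e r p; rewrite /h mulrDr scalerAr.
  exact: (intertwine_linear f'L hL (@T_lin _) (@T_lin _)).
(* The equation on N, rather than its substitution, lets the sizes n + m.+1 and
   (n + m).+1 be exchanged in the dependent types. *)
elim: m N le_a le_b b => [|m IHm] N le_a le_b b eN.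
  move: eN le_a le_b; rewrite addn0 => -> le_a le_b.
  rewrite (shiftY_id d_gt0).
  elim/(@Yokonuma1_ind K d q d_gt0): b => [c x y|s].
    by apply: lin => *; exact: shiftYP.
  have -> : shiftY le_b (t 0 ^+ s) = t n ^+ s.
    have tE : shiftY le_b (t 0) = t n.
      rewrite shiftY_t; congr (tY d q _).
      by apply: val_inj; rewrite /= addn0.
    have sX := shiftYX le_b (t 0) s.
    rewrite tE in sX.
    exact sX.
  by rewrite markov_trace_last_frameX markov_trace_frameX -scalerAr mulr1.
move: eN le_a le_b; rewrite addnS => -> le_a le_b.
have le_a' : (0 + n.+1 <= (n + m).+1)%N := connected_sum_subproof_l n m.
have le_b' : (n + m.+1 <= (n + m).+1)%N := connected_sum_subproof_r n m.
have aE : shiftY le_a a = inclY (shiftY le_a' a).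
  rewrite inclY_shift.
  exact: esym (shiftY_comp d_gt0 _ _ (le_a : (0 + 0 + n.+1 <= _)%N) a).
have IH c : T (shiftY le_a' a * shiftY le_b' c) = T a * T c by exact: IHm.
elim: {b}(markov_spanT d_gt0 b) => [c x y _ Tx _ Ty|b s|b c].
- by apply: lin => // *; exact: shiftYP.
- rewrite shiftYM (shiftY_inclr le_b') shiftYX shiftY_t aE.
  have -> : shift_frame le_b ord_max = ord_max.
    by apply: val_inj; rewrite /= addnS.
  rewrite mulrA -inclYM; apply: etrans (T_t _ s) _.
  by rewrite IH (T_t b s) scalerAr.
- rewrite (shiftYM _ (inclY b * g m)) (shiftYM _ (inclY b)).
  rewrite !(shiftY_inclr le_b') shiftY_g aE.
  have -> : shift_sigma le_b (ord_max : 'I_m.+2.-1)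
      = (ord_max : 'I_(n + m).+2.-1).
    exact: val_inj.
  rewrite !mulrA -inclYM; apply: etrans (markov_trace_cross _ _) _.
  by rewrite TC -mulrA -shiftYM IH mulrCA (TC b c) -(markov_trace_cross b c).
Qed.

End Trace.

(** * The specialized trace *)

Section SpecializedTrace.
Variables (K : fieldType) (d : nat) (q : K) (d_gt0 : (0 < d)%N).
Local Notation Y n := (Yokonuma d q n).
Local Notation g n := (@gY K d q n.+2 ord_max).
Local Notation t n := (@tY K d q n.+1 ord_max).
Variables (tr : forall n, {linear Y n -> {mpoly K[d.-1.+1]}}).
Hypothesis trP : Juyumaya_trace tr.
Variable x : nat -> K.
Hypothesis x0 : x 0 = 1.

Lemma specialize_linear : linear (@specialize K d x).
Proof.
by move=> c p r; rewrite /specialize mpoly.mmapD mpoly.mmapZ mul_polyC.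
Qed.

Lemma specializeM p r :
  @specialize K d x (p * r) = specialize x p * specialize x r.
Proof. exact: rmorphM. Qed.

Lemma specialize1 : @specialize K d x 1 = 1.
Proof. exact: rmorph1. Qed.

Lemma specializeX i :
  @specialize K d x 'X_i = if i == ord0 then 'X else (x i)%:P.
Proof. by rewrite /specialize mpoly.mmapX mpoly.mmap1U. Qed.

Definition strace n (a : Y n) : {poly K} := specialize x (tr n a).

Lemma strace_linear n : linear (@strace n).
Proof. by move=> c a b; rewrite /strace linearP specialize_linear. Qed.

Lemma straceC n (a b : Y n) : strace (a * b) = strace (b * a).
Proof. exact: congr1 (traceC trP a b). Qed.

Lemma strace1 n : strace (1 : Y n) = 1.
Proof. by rewrite /strace (trace1 trP) specialize1. Qed.

Lemma strace_g n (a : Y n.+1) : strace (inclY a * g n) = 'X * strace a.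
Proof. by rewrite /strace (trace_g trP) specializeM specializeX. Qed.

Lemma strace_t n (a : Y n) s : (s < d)%N ->
  strace (inclY a * t n ^+ s) = x s *: strace a.
Proof.
case: s => [|s] lt_sd.
  by rewrite mulr1 /strace (trace_incl trP) x0 scale1r.
have lt_sd1 : (s < d.-1)%N by rewrite ltn_predRL.
rewrite /strace (trace_t trP a (Ordinal lt_sd1)) specializeM specializeX.
by rewrite mul_polyC.
Qed.

(** Both [t ^+ s] and [w ^+ s] depend on [s] modulo [d] only. *)
Lemma strace_tX w n (a : Y n) s : w ^+ d = 1 ->
    (forall k, (k < d)%N -> x k = w ^+ k) ->
  strace (inclY a * t n ^+ s) = w ^+ s *: strace a.
Proof.
move=> w_d xw; rewrite -(expr_mod s (@tYX_d K d q n.+1 ord_max)).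
by rewrite strace_t ?ltn_pmod // xw ?ltn_pmod // expr_mod.
Qed.

Lemma braidY1 n : braidY d q (1%g : framed_braid n) = 1.
Proof. by rewrite /braidY braid_modular_word; exact: wordY_nil. Qed.

Lemma braidYX n (alpha : framed_braid n) s :
  braidY d q (alpha ^+ s)%g = braidY d q alpha ^+ s.
Proof.
elim: s => [|s IHs]; first exact: braidY1.
by rewrite expgS braidYM IHs [RHS]exprS.
Qed.

Lemma braidY_connected_sum n m
    (alpha : framed_braid n.+1) (beta : framed_braid m.+1) :
  braidY d q (connected_sum alpha beta)
  = shiftY (connected_sum_subproof_l n m) (braidY d q alpha)
    * shiftY (connected_sum_subproof_r n m) (braidY d q beta).
Proof. by rewrite /connected_sum braidYM !braidY_shift. Qed.

Lemma strace_connected_sum w n m (alpha : framed_braid n.+1)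
    (beta : framed_braid m.+1) :
    w ^+ d = 1 -> (forall k, (k < d)%N -> x k = w ^+ k) ->
  specialized_trace tr x (connected_sum alpha beta)
  = specialized_trace tr x alpha * specialized_trace tr x beta.
Proof.
move=> w_d xw; rewrite /specialized_trace braidY_connected_sum.
have strace_tw k (a : Y k) s : strace (inclY a * t k ^+ s) = w ^+ s *: strace a.
  exact: strace_tX.
exact: (markov_trace_connected_sum d_gt0 strace_linear straceC strace1 strace_g
  strace_tw).
Qed.

(** On one strand the connected sum is the product, so multiplicativity of the
    trace on the powers of a single framing says that [x] is multiplicative; the
    range reaches [k = d], where the framing is trivial and [x d = 1]. *)
Lemma frame_multiplicative : x d = 1 ->
    (forall alpha beta : framed_braid 1,
      specialized_trace tr x (connected_sum alpha beta)
      = specialized_trace tr x alpha * specialized_trace tr x beta) ->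
  forall k, (k <= d)%N -> x k = x 1 ^+ k.
Proof.
move=> x_d multiplicative.
pose tau := pgen (@framed_braid_rel 1) (inr ord_max).
have traceE k : (k <= d)%N -> specialized_trace tr x (tau ^+ k)%g = (x k)%:P.
  rewrite /specialized_trace braidYX braidY_frame -[specialize x _]/(strace _).
  rewrite leq_eqVlt => /orP[/eqP ->|lt_kd]; first by rewrite tYX_d strace1 x_d.
  by rewrite -[_ ^+ k]mul1r -(@inclY1 K d q 0) strace_t // strace1 alg_polyC.
elim=> [|k IHk] lt_kd; first by rewrite x0.
have le_kd := ltnW lt_kd.
apply: polyC_inj; rewrite exprSr -(IHk le_kd) polyCM -!traceE //.
rewrite -multiplicative /specialized_trace braidY_connected_sum.
rewrite !(shiftY_id d_gt0) -(braidYM d q (tau ^+ k)%g (tau ^+ 1)%g).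
by rewrite expg1 -expgSr.
Qed.

End SpecializedTrace.

Section ESolution.
Variables (R : realType) (d : nat) (D : {set 'I_d}).
Hypotheses (d_gt0 : (0 < d)%N) (D_neq0 : D != set0).

Lemma E_solution0 : E_solution R D 0 = 1.
Proof. by case: (E_solution_E_system R d_gt0 D_neq0). Qed.

Lemma E_solution_d : E_solution R D d = 1.
Proof.
rewrite -E_solution0 !E_solutionE; congr (_ * _); apply: eq_bigr => m _.
by rewrite root_expiX_d.
Qed.

End ESolution.

Theorem proposition3p6 (R : realType) (d : nat) (d_gt0 : (0 < d)%N)
    (q : R[i]) (q_neq0 : q != 0)
    (tr : forall n, {linear Yokonuma d q n -> {mpoly R[i][d.-1.+1]}})
    (trP : Juyumaya_trace tr)
    (D : {set 'I_d}) (D_neq0 : D != set0) :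
  (forall (n m : nat) (alpha : framed_braid n.+1) (beta : framed_braid m.+1),
      specialized_trace tr (E_solution R D) (connected_sum alpha beta)
      = specialized_trace tr (E_solution R D) alpha
        * specialized_trace tr (E_solution R D) beta)
  <-> (E_solution R D 1 ^+ d = 1
       /\ forall k : nat, (1 <= k <= d.-1)%N ->
            E_solution R D k = E_solution R D 1 ^+ k).
Proof.
have x0 := E_solution0 R d_gt0 D_neq0; have x_d := E_solution_d R d_gt0 D_neq0.
split=> [multiplicative|[w_d xw] n m alpha beta].
  have xX := frame_multiplicative d_gt0 trP x0 x_d (multiplicative 0 0).
  split=> [|k /andP[_ le_kd]]; first by rewrite -xX.
  by apply: xX; apply: leq_trans le_kd (leq_pred d).
apply: (strace_connected_sum d_gt0 trP x0 alpha beta w_d) => -[|k] lt_kd.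
  by rewrite x0.
by apply: xw; rewrite ltn_predRL.
Qed.
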